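(* Let $\tau:E\to M$ be an affine bundle modelled on a vector bundle $V\to M$, with bidual vector bundle $\tilde E\to M$, and suppose a (vector) Lie algebroid structure on $\tilde E$ is given. Let $\Lambda$ be the associated linear Poisson tensor on the total space of $E^\dagger=\tilde E^*$, and let $\frac{\partial}{\partial\mu_0}$ be the vertical vector field on $E^\dagger$ generating the flow $\varphi\mapsto\varphi+s\,e^0_m$ ($\varphi\in E^\dagger_m$, $s\in\mathbb{R}$), where $e^0_m\in E_m^\dagger$ is the constant function $1$. Then the bracket of any two sections of $\tilde E$ in the image of $i$ lies in the image of $\boldsymbol{i}$ if and only if $\frac{\partial}{\partial\mu_0}$ is a symmetry of the Poisson tensor, i.e. $\mathcal{L}_{\partial/\partial\mu_0}\Lambda=0$.
   Context: All bundles are smooth of finite rank. For $m\in M$, $E_m^\dagger=\mathrm{Aff}(E_m,\mathbb{R})$ is the vector space of affine functions on $E_m$; these form the vector bundle $E^\dagger\to M$, and $\tilde E=(E^\dagger)^*$. For $\varphi\in E^\dagger_m$ let $\boldsymbol{\varphi}\in V_m^*$ be its linear part. The canonical immersion is $i:E\to\tilde E$, $i(a)(\varphi)=\varphi(a)$, with linear part $\boldsymbol{i}:V\to\tilde E$, $\boldsymbol{i}(\boldsymbol{v})(\varphi)=\boldsymbol{\varphi}(\boldsymbol{v})$. A section $\zeta$ of $\tilde E$ determines the fibrewise linear function $\widehat\zeta$ on $E^\dagger$, $\widehat\zeta(\varphi)=\langle\zeta_m,\varphi\rangle$ for $\varphi\in E^\dagger_m$. Given a Lie algebroid structure on $\tilde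 E$ with anchor $\tilde\rho$, the associated Poisson bracket on $E^\dagger$ is determined by $\{\widehat\zeta_1,\widehat\zeta_2\}=\widehat{[\zeta_1,\zeta_2]}$, $\{\widehat\zeta,g\}=\tilde\rho(\zeta)(g)$ and $\{f,g\}=0$, for $\zeta,\zeta_1,\zeta_2$ sections of $\tilde E$ and $f,g$ functions on $M$ (pulled back to $E^\dagger$). In a local frame of $\tilde E$ of the form $e_0=i(\sigma)$, $e_\alpha=\boldsymbol{i}(\boldsymbol{e}_\alpha)$, with $\sigma$ a local section of $E$ and $(\boldsymbol{e}_\alpha)$ a local frame of $V$, and with fibre coordinates $\mu_0=\widehat{e_0}$, $\mu_\alpha=\widehat{e_\alpha}$ on $E^\dagger$, the vector field above is the coordinate field $\partial/\partial\mu_0$. *)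

(* Defs.v *)
From HB Require Import structures.
From mathcomp Require Import all_boot all_order all_algebra.
From mathcomp Require Import all_classical all_reals all_analysis.

Set Implicit Arguments.
Unset Strict Implicit.
Unset Printing Implicit Defensive.

Import Order.TTheory GRing.Theory Num.Theory.
Import numFieldNormedType.Exports.

Local Open Scope classical_set_scope.
Local Open Scope ring_scope.

Fixpoint Ck (R : realType) (n k : nat) (D : set 'rV[R]_n)
    (f : 'rV[R]_n -> R) : Prop :=
  match k with
  | 0%N => forall x, D x -> {for x, continuous f}
  | k'.+1 => (forall x, D x -> differentiable f x) /\
             (forall v : 'rV[R]_n, Ck k' D ('D_v f))
  end.

Definition smooth_on (R : realType) (n : nat) (D : set 'rV[R]_n)
    (f : 'rV[R]_n -> R) : Prop :=
  forall k, Ck k D f.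

(* [cinv] is the inverse of [cmap] from [cmap @` cdom] to [cdom]; the values of
   [cmap] outside [cdom] and of [cinv] outside [cmap @` cdom] are irrelevant. *)
Record chart (R : realType) (n : nat) (X : Type) := Chart {
  cdom : set X;
  cmap : X -> 'rV[R]_n;
  cinv : 'rV[R]_n -> X }.

Section Charts.
Context {R : realType} {n : nat} {X : Type}.
Variable A : set (chart R n X).

Definition csmooth_on (U : set X) (f : X -> R) : Prop :=
  forall c, A c -> smooth_on (cmap c @` (cdom c `&` U)) (f \o cinv c).

Definition csmooth (f : X -> R) : Prop := csmooth_on setT f.

(* the partial derivative of f at p with respect to the i-th coordinate of c *)
Definition pderiv (c : chart R n X) (i : 'I_n) (f : X -> R) (p : X) : R :=
  'D_(delta_mx 0 i) (f \o cinv c) (cmap c p).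

(* D is f |-> \sum_i u^i (d f / d x^i) (p), in every chart around p; only the
   values of D on smooth functions matter. *)
Definition tangent_vector (p : X) (D : (X -> R) -> R) : Prop :=
  forall c, A c -> cdom c p -> exists u : 'I_n -> R,
    forall f, csmooth f -> D f = \sum_i u i * pderiv c i f p.

(* P f g is the function Lambda(df, dg), where the bivector field Lambda has in
   each chart the smooth components Lambda^{ij} = - Lambda^{ji}; only the
   values of P on smooth functions matter. *)
Definition bivector_field (P : (X -> R) -> (X -> R) -> X -> R) : Prop :=
  forall c, A c -> exists L : 'I_n -> 'I_n -> 'rV[R]_n -> R,
    [/\ forall i j, smooth_on (cmap c @` cdom c) (L i j),
        forall i j x, (cmap c @` cdom c) x -> L i j x = - L j i x &
        forall f g p, csmooth f -> csmooth g -> cdom c p ->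
          P f g p = \sum_i \sum_j
            L i j (cmap c p) * pderiv c i f p * pderiv c j g p].

Record poisson_tensor := PoissonTensor {
  pb :> (X -> R) -> (X -> R) -> X -> R;
  pb_bivector : bivector_field pb;
  pb_jacobi : forall f g h p, csmooth f -> csmooth g -> csmooth h ->
    pb f (pb g h) p + pb g (pb h f) p + pb h (pb f g) p = 0 }.

(* Q is the Lie derivative of the bivector field P along the vector field with
   (global) flow Phi: for all p and all covectors df_p, dg_p, Q(df, dg)(p) is
   the derivative at s = 0 of (Phi_s^* P)(df, dg)(p)
     = P_{Phi_s p}(d(f o Phi_{-s}), d(g o Phi_{-s})). *)
Definition is_lie_derivative (Phi : R -> X -> X)
    (P Q : (X -> R) -> (X -> R) -> X -> R) : Prop :=
  forall f g p, csmooth f -> csmooth g ->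
    is_derive (0 : R) (1 : R)
      (fun s : R => P (f \o Phi (- s)) (g \o Phi (- s)) (Phi s p)) (Q f g p).

End Charts.

Record manifold (R : realType) (n : nat) := Manifold {
  mset :> topologicalType;
  matlas : set (chart R n mset);
  m_hausdorff : hausdorff_space mset;
  m_countable : @second_countable mset;
  m_cover : forall p, exists2 c, matlas c & cdom c p;
  m_dom_open : forall c, matlas c -> open (cdom c);
  m_im_open : forall c, matlas c -> open (cmap c @` cdom c);
  m_cancel : forall c p, matlas c -> cdom c p -> cinv c (cmap c p) = p;
  m_cmap_continuous : forall c p, matlas c -> cdom c p ->
    {for p, continuous (cmap c)};
  m_cinv_continuous : forall c x, matlas c -> (cmap c @` cdom c) x ->
    {for x, continuous (cinv c)};
  m_transition : forall c c' j, matlas c -> matlas c' ->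
    smooth_on (cmap c @` (cdom c `&` cdom c'))
      (fun x => cmap c' (cinv c x) 0 j) }.

Definition msmooth_on (R : realType) (n : nat) (M : manifold R n) :
  set M -> (M -> R) -> Prop := csmooth_on (@matlas R n M).

Definition msmooth (R : realType) (n : nat) (M : manifold R n) :
  (M -> R) -> Prop := csmooth (@matlas R n M).

(* a family, for m in tdom, of bijections from the fibre F m onto R^k *)
Record triv (R : realType) (k : nat) (M : Type) (F : M -> Type) := Triv {
  tdom : set M;
  tmap : forall m, F m -> 'rV[R]_k;
  tinv : forall m, 'rV[R]_k -> F m }.

(* The transition functions are fibrewise linear, so they are smooth if and
   only if they are smooth in m on each fixed vector c of R^k. *)
Record vbundle (R : realType) (n : nat) (M : manifold R n) (k : nat) :=
  VBundle {
  vfib :> M -> lmodType R;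
  vatlas : set (triv R k vfib);
  v_cover : forall m, exists2 t, vatlas t & tdom t m;
  v_open : forall t, vatlas t -> open (tdom t);
  v_tmapK : forall t m, vatlas t -> tdom t m -> cancel (tmap t (m:=m)) (tinv t m);
  v_tinvK : forall t m, vatlas t -> tdom t m -> cancel (tinv t m) (tmap t (m:=m));
  v_linear : forall t m, vatlas t -> tdom t m -> linear (tmap t (m:=m));
  v_transition : forall t t' (c : 'rV[R]_k) j, vatlas t -> vatlas t' ->
    msmooth_on (tdom t `&` tdom t') (fun m => tmap t' (tinv t m c) 0 j) }.

Section VBundleTheory.
Context {R : realType} {n : nat} {M : manifold R n} {k : nat}.
Variable W : vbundle M k.

Definition vsmooth (s : forall m, W m) : Prop :=
  forall t j, vatlas t -> msmooth_on (tdom t) (fun m => tmap t (s m) 0 j).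

Definition total : Type := {m : M & W m}.

Definition total_chart (c : chart R n M) (t : triv R k (vfib W)) :
    chart R (n + k) total :=
  Chart [set p : total | cdom c (projT1 p) /\ tdom t (projT1 p)]
    (fun p => row_mx (cmap c (projT1 p)) (tmap t (projT2 p)))
    (fun z => existT _ (cinv c (lsubmx z)) (tinv t _ (rsubmx z))).

Definition total_atlas : set (chart R (n + k) total) :=
  [set C | exists c t, [/\ matlas c, vatlas t & C = total_chart c t]].

Record lie_algebroid := LieAlgebroid {
  anchor : forall m, W m -> (M -> R) -> R;
  anchor_tangent : forall m (w : W m), tangent_vector (@matlas R n M) m (anchor w);
  anchor_linear : forall m (a : R) (w w' : W m) (g : M -> R), msmooth g ->
    anchor (a *: w + w') g = a * anchor w g + anchor w' g;
  anchor_smooth : forall (s : forall m, W m) (g : M -> R), vsmooth s -> msmooth g ->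
    msmooth (fun m => anchor (s m) g);
  brk : (forall m, W m) -> (forall m, W m) -> forall m, W m;
  brk_smooth : forall s1 s2, vsmooth s1 -> vsmooth s2 -> vsmooth (brk s1 s2);
  brk_linear : forall (a : R) s1 s2 s m, vsmooth s1 -> vsmooth s2 -> vsmooth s ->
    brk (fun m => a *: s1 m + s2 m) s m = a *: brk s1 s m + brk s2 s m;
  brk_antisym : forall s1 s2 m, vsmooth s1 -> vsmooth s2 ->
    brk s1 s2 m = - brk s2 s1 m;
  brk_jacobi : forall s1 s2 s3 m, vsmooth s1 -> vsmooth s2 -> vsmooth s3 ->
    brk s1 (brk s2 s3) m + brk s2 (brk s3 s1) m + brk s3 (brk s1 s2) m = 0;
  brk_leibniz : forall (g : M -> R) s1 s2 m,
    msmooth g -> vsmooth s1 -> vsmooth s2 ->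
    brk s1 (fun m => g m *: s2 m) m =
      g m *: brk s1 s2 m + anchor (s1 m) g *: s2 m }.

End VBundleTheory.
Arguments total_atlas {R n M k} W _.

Section SmoothLemmas.
Context {R : realType}.

Lemma near_eq_continuous (T : topologicalType) (f g : T -> R) (x : T) :
  (\forall y \near x, f y = g y) -> {for x, continuous f} -> {for x, continuous g}.
Proof.
move=> fg; rewrite /prop_for /continuous_at -(nbhs_singleton fg).
by apply: cvg_trans; apply: near_eq_cvg.
Qed.

Lemma near_eq_differentiable (V : normedModType R) (f g : V -> R) (x : V) :
  (\forall y \near x, f y = g y) -> differentiable f x -> differentiable g x.
Proof.
move=> fg df; have -> : g = f + (g - f) by rewrite addrC subrK.
apply: differentiableD => //.
have h0 : \forall y \near x, (g - f) y = 0.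
  by near=> y; rewrite /= fctE; apply/eqP; rewrite subr_eq0 eq_sym; apply/eqP; near: y.
have h1 : \forall y \near (0 : V), (g - f) (y + x) = 0.
  by move: h0; rewrite (near_shift 0) subr0.
have hx : (g - f) x = 0 by exact: (nbhs_singleton h0).
have E : (g - f) \o shift x = cst ((g - f) x) + (\0 : {linear V -> R}) +o_ 0 id.
  apply/eqaddoP => e e0; near=> y.
  have -> : ((g - f) \o shift x - (cst ((g - f) x) + (\0 : {linear V -> R}))) y = 0.
    rewrite /= !fctE /= -[g _ - f _]/((g - f) (y + x)).
    rewrite -[g x - f x]/((g - f) x) hx addr0 subr0; by near: y.
  by rewrite normr0 mulr_ge0 // ltW.
have C : continuous (\0 : {linear V -> R}) by move=> ?; exact: cvg_cst.
by apply/diff_locallyP; rewrite (diff_unique C E).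
Unshelve. all: by end_near. Qed.

Lemma Ck_ext n k (D : set 'rV[R]_n) f g : open D ->
  (forall x, D x -> f x = g x) -> Ck k D f -> Ck k D g.
Proof.
move=> oD; have nD x (f' g' : 'rV[R]_n -> R) : (forall x, D x -> f' x = g' x) ->
    D x -> \forall y \near x, f' y = g' y.
  by move=> fg Dx; near=> y; apply: fg; near: y; exact: open_nbhs_nbhs.
elim: k f g => [|k IH] f g fg /=.
  by move=> cf x Dx; exact: near_eq_continuous (nD x f g fg Dx) (cf x Dx).
move=> [df cf]; split=> [x Dx|v].
  by apply: near_eq_differentiable (df x Dx); exact: (nD x f g fg Dx).
by apply: IH (cf v) => x Dx; apply: near_eq_derive; exact: (nD x f g fg Dx).
Unshelve. all: by end_near. Qed.

Lemma Ck_cst n k (D : set 'rV[R]_n) (a : R) : Ck k D (fun=> a).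
Proof.
elim: k a => [|k IH] a /=; first by move=> x _; exact: cst_continuous.
split=> [x _|v]; first exact: differentiable_cst.
have -> : 'D_v (fun=> a) = (fun=> 0) :> ('rV[R]_n -> R).
  by apply/funext => x; exact: derive_cst.
exact: IH.
Qed.

Lemma Ck_add n k (D : set 'rV[R]_n) f g : open D ->
  Ck k D f -> Ck k D g -> Ck k D (fun x => f x + g x).
Proof.
move=> oD; elim: k f g => [|k IH] f g /=.
  by move=> cf cg x Dx; apply: continuousD; [exact: cf|exact: cg].
move=> [df cf] [dg cg]; split=> [x Dx|v].
  by apply: differentiableD; [exact: df|exact: dg].
apply: Ck_ext (IH _ _ (cf v) (cg v)) => // x Dx /=.
by rewrite -deriveD //; apply: diff_derivable; [exact: df|exact: dg].
Qed.

Lemma Ck_scale n k (D : set 'rV[R]_n) (a : R) f : open D ->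
  Ck k D f -> Ck k D (fun x => a * f x).
Proof.
move=> oD; elim: k f => [|k IH] f /=.
  by move=> cf x Dx; apply: continuousM; [exact: cst_continuous|exact: cf].
move=> [df cf]; split=> [x Dx|v].
  by apply: (differentiableZ a); exact: df.
apply: Ck_ext (IH _ (cf v)) => // x Dx /=.
rewrite -[RHS]/('D_v (a *: f) x) deriveZ //.
by apply: diff_derivable; exact: df.
Qed.

Lemma chart_im_open n (M : manifold R n) (c : chart R n M) (U : set M) :
  matlas c -> open U -> open (cmap c @` (cdom c `&` U)).
Proof.
move=> Ac oU; rewrite openE => x [p [cp Up] <-].
have cx : (cmap c @` cdom c) (cmap c p) by exists p.
have nU : nbhs (cmap c p) (cinv c @^-1` U).
  apply: (m_cinv_continuous Ac cx); rewrite /= m_cancel //.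
  exact: open_nbhs_nbhs.
have nI : nbhs (cmap c p) (cmap c @` cdom c).
  by apply: open_nbhs_nbhs; split => //; exact: m_im_open.
rewrite /interior; apply: filterS2 nU nI => y Uy [q cq qy].
by exists q => //; split => //; move: Uy; rewrite /preimage /= -qy m_cancel.
Qed.

Lemma msmooth_on_affcomb n (M : manifold R n) (U : set M) r (a : R)
    (b : 'I_r -> R) (g : 'I_r -> M -> R) (f : M -> R) : open U ->
  (forall i, msmooth_on U (g i)) ->
  (forall m, U m -> f m = a + \sum_i b i * g i m) -> msmooth_on U f.
Proof.
move=> oU sg fE c Ac k; have oD := chart_im_open Ac oU.
apply: (@Ck_ext _ _ _ (fun x => a + \sum_i b i * (g i \o cinv c) x)) => //.
  by move=> x [p [cp Up] <-] /=; rewrite m_cancel // fE.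
apply: Ck_add => //; first exact: Ck_cst.
have -> : (fun x => \sum_i b i * (g i \o cinv c) x) =
          (fun x => \sum_(i <- index_enum 'I_r) b i * (g i \o cinv c) x) by [].
elim: (index_enum _) => [|i s IH].
  by under eq_fun do rewrite big_nil; exact: Ck_cst.
under eq_fun do rewrite big_cons.
by apply: Ck_add => //; apply: Ck_scale => //; exact: sg.
Qed.

End SmoothLemmas.

Section DualSpace.
Variables (R : realType) (W : lmodType R).

Definition linear_form : {pred W -> R^o} :=
  fun f => `[< linear (f : W -> R^o) >].

Record dual := Dual { dual_fun :> W -> R^o; dualP : dual_fun \in linear_form }.

HB.instance Definition _ := [isSub for dual_fun].
HB.instance Definition _ := [Choice of dual by <:].

Fact linear_form_submod : submod_closed linear_form.
Proof.
split=> [|a f g /asboolP lf /asboolP lg]; apply/asboolP => b u v.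
  by rewrite /= scaler0 addr0.
rewrite -[LHS]/(a *: f (b *: u + v) + g (b *: u + v)).
rewrite -[RHS]/(b *: (a *: f u + g u) + (a *: f v + g v)).
by rewrite lf lg !scalerDr !scalerA (mulrC a b) addrACA.
Qed.

HB.instance Definition _ :=
  GRing.isSubmodClosed.Build R (W -> R^o) linear_form linear_form_submod.
HB.instance Definition _ := [SubChoice_isSubLmodule of dual by <:].

Lemma dual_linear (z : dual) : linear (z : W -> R^o).
Proof. by apply/asboolP; exact: dualP. Qed.

HB.instance Definition _ (z : dual) :=
  GRing.isLinear.Build R W R^o *:%R z (dual_linear z).

Lemma dual_ext (z z' : dual) : z =1 z' -> z = z'.
Proof. by move=> zz'; apply/val_inj/funext. Qed.

Lemma dual_comb (a : R) (z z' : dual) w : (a *: z + z') w = a * z w + z' w.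
Proof. by []. Qed.

End DualSpace.

Section DualBundle.
Context {R : realType} {n : nat} {M : manifold R n} {k : nat}.
Variable W : vbundle M k.

Definition dual_fib (m : M) : lmodType R := dual (W m).

Definition dual_tmap (t : triv R k (vfib W)) m (z : dual_fib m) : 'rV[R]_k :=
  \row_i z (tinv t m (delta_mx 0 i)).

(* the test made by [insubd] succeeds for m in [tdom t] *)
Definition dual_tinv (t : triv R k (vfib W)) m (c : 'rV[R]_k) : dual_fib m :=
  insubd (0 : dual (W m)) (fun w : W m => \sum_i c 0 i * tmap t w 0 i : R^o).

Definition dual_triv (t : triv R k (vfib W)) : triv R k dual_fib :=
  Triv (tdom t) (dual_tmap t) (dual_tinv t).

Definition dual_atlas : set (triv R k dual_fib) := dual_triv @` @vatlas _ _ _ _ W.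

Lemma dual_tinvE t m c w : vatlas t -> tdom t m ->
  dual_tinv t m c w = \sum_i c 0 i * tmap t w 0 i.
Proof.
move=> At tm; rewrite [dual_fun _](insubdK (0 : dual (W m))) //.
apply/asboolP => a u v; rewrite v_linear // scaler_sumr -big_split /=.
by apply: eq_bigr => i _; rewrite !mxE mulrDr mulrCA.
Qed.

Fact dual_cover m : exists2 t, dual_atlas t & tdom t m.
Proof. by have [t At tm] := v_cover W m; exists (dual_triv t) => //; exists t. Qed.

Fact dual_open t : dual_atlas t -> open (tdom t).
Proof. by move=> [u Au <-]; exact: v_open. Qed.

Lemma tinv_linear (t : triv R k (vfib W)) m : vatlas t -> tdom t m ->
  linear (tinv t m).
Proof.
move=> At tm a c d; apply: (can_inj (v_tmapK At tm)).
by rewrite v_linear // !v_tinvK.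
Qed.

Lemma dual_form_tinv (t : triv R k (vfib W)) m (z : dual_fib m) c :
  vatlas t -> tdom t m ->
  z (tinv t m c) = \sum_i c 0 i * z (tinv t m (delta_mx 0 i)).
Proof.
move=> At tm; pose f : {linear _ -> _} := HB.pack_for {linear 'rV[R]_k -> W m}
  (tinv t m) (GRing.isLinear.Build R _ _ _ _ (tinv_linear At tm)).
rewrite -[tinv t m]/(f : _ -> _) {1}(row_sum_delta c) !linear_sum.
by apply: eq_bigr => i _; rewrite !linearZ.
Qed.

Fact dual_tmapK t m : dual_atlas t -> tdom t m ->
  cancel (tmap t (m:=m)) (tinv t m).
Proof.
move=> [u Au <-] /= um z; apply: dual_ext => w; rewrite dual_tinvE //.
rewrite -[in RHS](v_tmapK Au um w) dual_form_tinv //.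
by apply: eq_bigr => i _; rewrite mxE mulrC.
Qed.

Fact dual_tinvK t m : dual_atlas t -> tdom t m ->
  cancel (tinv t m) (tmap t (m:=m)).
Proof.
move=> [u Au <-] /= um c; apply/rowP => j; rewrite mxE dual_tinvE //.
rewrite v_tinvK // (bigD1 j) //= big1 ?addr0 => [|i ij].
  by rewrite mxE !eqxx mulr1.
by rewrite mxE (negbTE ij) andbF mulr0.
Qed.

Fact dual_tlinear t m : dual_atlas t -> tdom t m -> linear (tmap t (m:=m)).
Proof. by move=> [u Au <-] um a z z'; apply/rowP => i; rewrite !mxE. Qed.

Fact dual_transition t t' (c : 'rV[R]_k) j : dual_atlas t -> dual_atlas t' ->
  msmooth_on (tdom t `&` tdom t') (fun m => tmap t' (tinv t m c) 0 j).
Proof.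
move=> [u Au <-] [u' Au' <-] /=; rewrite setIC.
apply: (@msmooth_on_affcomb _ _ _ _ k 0 (fun i => c 0 i)
          (fun i m => tmap u (tinv u' m (delta_mx 0 j)) 0 i)).
- by apply: openI; exact: v_open.
- by move=> i; exact: v_transition.
by move=> m [um' um]; rewrite mxE dual_tinvE // add0r.
Qed.

Definition dual_bundle : vbundle M k :=
  VBundle dual_cover dual_open dual_tmapK dual_tinvK dual_tlinear
    dual_transition.

End DualBundle.

(* x + v is written [act x v]; [act] makes each fibre an affine space over the
   corresponding fibre of V, and the local trivialisations are fibrewise affine
   isomorphisms whose linear parts are smooth local trivialisations of V: the
   last two fields are the smoothness of the two transition functions. *)
Record affbundle (R : realType) (n : nat) (M : manifold R n) (k : nat)
    (V : vbundle M k) := AffBundle {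
  afib :> M -> Type;
  act : forall m, afib m -> V m -> afib m;
  act0 : forall m (x : afib m), act x 0 = x;
  actD : forall m (x : afib m) u v, act x (u + v) = act (act x u) v;
  act_torsor : forall m (x y : afib m), exists! v, act x v = y;
  aatlas : set (triv R k afib);
  a_cover : forall m, exists2 t, aatlas t & tdom t m;
  a_open : forall t, aatlas t -> open (tdom t);
  a_tmapK : forall t m, aatlas t -> tdom t m -> cancel (tmap t (m:=m)) (tinv t m);
  a_tinvK : forall t m, aatlas t -> tdom t m -> cancel (tinv t m) (tmap t (m:=m));
  a_affine : forall t m, aatlas t -> tdom t m ->
    exists L : {linear V m -> 'rV[R]_k},
      forall x v, tmap t (act x v) = tmap t x + L v;
  a_transition : forall t t' (c : 'rV[R]_k) j, aatlas t -> aatlas t' ->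
    msmooth_on (tdom t `&` tdom t') (fun m => tmap t' (tinv t m c) 0 j);
  (* with L the linear part of t over m, the value is L (tinv s m c) *)
  a_linear_smooth : forall t s (c : 'rV[R]_k) j, aatlas t -> vatlas s ->
    msmooth_on (tdom t `&` tdom s)
      (fun m => tmap t (act (tinv t m 0) (tinv s m c)) 0 j);
  (* with L the linear part of t over m, the hypothesis says L (v m) = c *)
  a_linear_inv_smooth : forall t s (c : 'rV[R]_k) j (v : forall m, V m),
    aatlas t -> vatlas s ->
    (forall m, tdom t m -> act (tinv t m 0) (v m) = tinv t m c) ->
    msmooth_on (tdom t `&` tdom s) (fun m => tmap s (v m) 0 j) }.

Section AffineFunctions.
Variables (R : realType) (V : lmodType R) (E : Type) (add : E -> V -> E).

Definition affine_form : {pred E -> R^o} :=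
  fun f => `[< exists L : {linear V -> R^o},
                 forall x v, f (add x v) = f x + L v >].

Record affine_fun :=
  AffineFun { afun :> E -> R^o; affineP : afun \in affine_form }.

HB.instance Definition _ := [isSub for afun].
HB.instance Definition _ := [Choice of affine_fun by <:].

Fact affine_form_submod : submod_closed affine_form.
Proof.
split=> [|a f g /asboolP [L fL] /asboolP [L' gL']]; apply/asboolP.
  by exists \0 => x v; rewrite /= addr0.
exists (a \*: L \+ L') => x v.
rewrite -[LHS]/(a *: f (add x v) + g (add x v)) fL gL'.
by rewrite -[in RHS]/((a *: f x + g x) + (a *: L v + L' v)) scalerDr addrACA.
Qed.

HB.instance Definition _ :=
  GRing.isSubmodClosed.Build R (E -> R^o) affine_form affine_form_submod.
HB.instance Definition _ := [SubChoice_isSubLmodule of affine_fun by <:].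

Fact affine_linear_part (f : affine_fun) :
  exists L : {linear V -> R^o}, forall x v, f (add x v) = f x + L v.
Proof. by apply/asboolP; exact: affineP. Qed.

(* unique as soon as E is nonempty *)
Definition linear_part (f : affine_fun) : {linear V -> R^o} :=
  sval (cid (affine_linear_part f)).

Lemma linear_partE (f : affine_fun) x v : f (add x v) = f x + linear_part f v.
Proof. by rewrite /linear_part; case: cid. Qed.

Lemma affine_ext (f g : affine_fun) : f =1 g -> f = g.
Proof. by move=> fg; apply/val_inj/funext. Qed.

Fact affine_one_subproof : (fun _ : E => 1 : R^o) \in affine_form.
Proof. by apply/asboolP; exists \0 => x v; rewrite /= addr0. Qed.

Definition affine_one : affine_fun := AffineFun affine_one_subproof.

End AffineFunctions.

Section DaggerBundle.
Context {R : realType} {n : nat} {M : manifold R n} {k : nat}.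
Context {V : vbundle M k}.
Variable E : affbundle V.

Definition asmooth (s : forall m, E m) : Prop :=
  forall t j, aatlas t -> msmooth_on (tdom t) (fun m => tmap t (s m) 0 j).

Definition dagger_fib (m : M) : lmodType R := affine_fun (act (m:=m) (a:=E)).

(* In terms of a trivialisation of E with fibre coordinates y^1, ..., y^k and
   zero section sigma, phi = mu_0 + \sum_j mu_j y^j has the coordinates
   mu_0 = phi(sigma) and mu_j = phi(sigma + e_j) - phi(sigma). *)
Definition dagger_tmap (t : triv R k (afib E)) m (f : dagger_fib m) :
    'rV[R]_(1 + k) :=
  row_mx (f (tinv t m 0))%:M
    (\row_j (f (tinv t m (delta_mx 0 j)) - f (tinv t m 0))).

(* the test made by [insubd] succeeds for m in [tdom t] *)
Definition dagger_tinv (t : triv R k (afib E)) m (c : 'rV[R]_(1 + k)) :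
    dagger_fib m :=
  insubd (0 : affine_fun (act (m:=m) (a:=E)))
    (fun x : E m => lsubmx c 0 0 + \sum_j rsubmx c 0 j * tmap t x 0 j : R^o).

Definition dagger_triv (t : triv R k (afib E)) : triv R (1 + k) dagger_fib :=
  Triv (tdom t) (dagger_tmap t) (dagger_tinv t).

Definition dagger_atlas : set (triv R (1 + k) dagger_fib) :=
  dagger_triv @` @aatlas _ _ _ _ _ E.

Lemma dagger_tinvE t m c x : aatlas t -> tdom t m ->
  dagger_tinv t m c x = lsubmx c 0 0 + \sum_j rsubmx c 0 j * tmap t x 0 j.
Proof.
move=> At tm; rewrite [afun _](insubdK (0 : affine_fun (act (m:=m) (a:=E)))) //.
have [L tL] := a_affine At tm.
have lin : linear (fun v : V m => \sum_j rsubmx c 0 j * L v 0 j : R^o).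
  move=> a u v; rewrite linearP scaler_sumr -big_split /=.
  by apply: eq_bigr => i _; rewrite !mxE mulrDr mulrCA.
pose l : {linear V m -> R^o} := HB.pack_for {linear V m -> R^o}
  (fun v : V m => \sum_j rsubmx c 0 j * L v 0 j : R^o)
  (GRing.isLinear.Build R _ _ _ _ lin).
apply/asboolP; exists l => y v; rewrite /= -addrA -big_split /=; congr (_ + _).
by apply: eq_bigr => i _; rewrite tL -mulrDr; congr (_ * _); rewrite mxE.
Qed.

Fact dagger_cover m : exists2 t, dagger_atlas t & tdom t m.
Proof.
by have [t At tm] := a_cover E m; exists (dagger_triv t) => //; exists t.
Qed.

Fact dagger_open t : dagger_atlas t -> open (tdom t).
Proof. by move=> [u Au <-]; exact: a_open. Qed.

Lemma dagger_coord (t : triv R k (afib E)) m (f : dagger_fib m) x :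
  aatlas t -> tdom t m ->
  f x = f (tinv t m 0) +
    \sum_j (f (tinv t m (delta_mx 0 j)) - f (tinv t m 0)) * tmap t x 0 j.
Proof.
move=> At tm; have [L tL] := a_affine At tm.
set o := tinv t m 0.
have to : tmap t o = 0 by exact: a_tinvK.
have tv y : exists v, act o v = y by have [v [e _]] := act_torsor o y; exists v.
have injL u v : L u = L v -> u = v.
  move=> Luv; have e : act o u = act o v.
    by apply: (can_inj (a_tmapK At tm)); rewrite !tL Luv.
  by have [w [_ wu]] := act_torsor o (act o v); rewrite -(wu v) // -(wu u).
pose e j := sval (cid (tv (tinv t m (delta_mx 0 j)))).
have eE j : act o (e j) = tinv t m (delta_mx 0 j) by rewrite /e; case: cid.
have Le j : L (e j) = delta_mx 0 j.
  by rewrite -[RHS](a_tinvK At tm) -eE tL to add0r.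
have [v <-] := tv x.
have vE : v = \sum_j L v 0 j *: e j.
  apply: injL; rewrite [LHS]row_sum_delta linear_sum; apply: eq_bigr => j _.
  by rewrite linearZ Le.
rewrite {1}vE linear_partE linear_sum; congr (_ + _); apply: eq_bigr => j _.
by rewrite linearZ -eE linear_partE addrC addKr tL to add0r mulrC.
Qed.

Fact dagger_tmapK t m : dagger_atlas t -> tdom t m ->
  cancel (tmap t (m:=m)) (tinv t m).
Proof.
move=> [u Au <-] /= um f; apply: affine_ext => x.
rewrite dagger_tinvE // row_mxKl row_mxKr [RHS](@dagger_coord u) //.
by rewrite mxE eqxx; congr (_ + _); apply: eq_bigr => j _; rewrite mxE.
Qed.

Fact dagger_tinvK t m : dagger_atlas t -> tdom t m ->
  cancel (tinv t m) (tmap t (m:=m)).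
Proof.
move=> [u Au <-] /= um c; rewrite /dagger_tmap -[RHS]hsubmxK.
have c0 : dagger_tinv u m c (tinv u m 0) = lsubmx c 0 0.
  by rewrite dagger_tinvE // a_tinvK // big1 ?addr0 // => i _; rewrite [X in _ * X]mxE mulr0.
congr row_mx; apply/rowP => j.
  by rewrite mxE c0 !ord1 eqxx.
rewrite mxE c0 dagger_tinvE // a_tinvK // addrC addKr (bigD1 j) //=.
rewrite big1 ?addr0 => [|i ij]; first by rewrite [X in _ * X]mxE !eqxx mulr1.
by rewrite [X in _ * X]mxE (negbTE ij) andbF mulr0.
Qed.

Fact dagger_tlinear t m : dagger_atlas t -> tdom t m ->
  linear (tmap t (m:=m)).
Proof.
move=> [u Au <-] /= um a f g; rewrite /dagger_tmap scale_row_mx add_row_mx.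
congr row_mx; apply/rowP => j; rewrite !mxE.
  by rewrite !ord1 eqxx !mulr1n.
rewrite -![(a *: f + g) _]/(a * f _ + g _) mulrBr.
by rewrite opprD addrACA.
Qed.

Fact dagger_transition t t' (c : 'rV[R]_(1 + k)) j :
  dagger_atlas t -> dagger_atlas t' ->
  msmooth_on (tdom t `&` tdom t') (fun m => tmap t' (tinv t m c) 0 j).
Proof.
move=> [u Au <-] [u' Au' <-] /=; rewrite setIC.
have oU : open (tdom u' `&` tdom u) by apply: openI; exact: a_open.
have sm d : msmooth_on (tdom u' `&` tdom u)
    (fun m => dagger_tinv u m c (tinv u' m d)).
  apply: (@msmooth_on_affcomb _ _ _ _ k (lsubmx c 0 0) (fun i => rsubmx c 0 i)
    (fun i m => tmap u (tinv u' m d) 0 i)) => //.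
    by move=> i; exact: a_transition.
  by move=> m [um' um]; rewrite dagger_tinvE.
case: (split_ordP j) => i ->; rewrite /dagger_tmap.
  rewrite (_ : (fun m => _) = fun m => dagger_tinv u m c (tinv u' m 0)) //.
  by apply/funext => m; rewrite row_mxEl mxE !ord1 eqxx mulr1n.
rewrite (_ : (fun m => _) = fun m =>
  dagger_tinv u m c (tinv u' m (delta_mx 0 i)) - dagger_tinv u m c (tinv u' m 0));
  last by apply/funext => m; rewrite row_mxEr mxE.
apply: (@msmooth_on_affcomb _ _ _ _ 2 0 (fun b => (-1) ^+ b) (fun b m =>
  dagger_tinv u m c (tinv u' m (if b == ord0 then delta_mx 0 i else 0)))) => //.
by move=> m _; rewrite !big_ord_recl big_ord0 /= expr0 expr1 mul1r mulN1r addr0 add0r.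
Qed.

(* E^dagger *)
Definition dagger : vbundle M (1 + k) :=
  VBundle dagger_cover dagger_open dagger_tmapK dagger_tinvK dagger_tlinear
    dagger_transition.

(* E tilde = (E^dagger)^* *)
Definition bidual : vbundle M (1 + k) := dual_bundle dagger.

Fact can_subproof m (x : E m) :
  (fun f : dagger m => (f : affine_fun _) x : R^o) \in @linear_form R (dagger m).
Proof. by apply/asboolP. Qed.

(* the canonical immersion i(x)(f) = f(x) *)
Definition can m (x : E m) : bidual m := Dual (can_subproof x).

Fact can_lin_subproof m (v : V m) :
  (fun f : dagger m => linear_part (f : affine_fun (act (m:=m) (a:=E))) v : R^o)
    \in @linear_form R (dagger m).
Proof.
apply/asboolP => a f g; have [t At tm] := a_cover E m; pose x := tinv t m 0.
have e (h : affine_fun (act (m:=m) (a:=E))) : linear_part h v = h (act x v) - h x.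
  by rewrite linear_partE addrC addKr.
rewrite !e -![(a *: f + g) _]/(a * f _ + g _).
by rewrite opprD addrACA; congr (_ + _); rewrite -mulrBr.
Qed.

(* its linear part i(v)(f) = (linear part of f)(v) *)
Definition can_lin m (v : V m) : bidual m := Dual (can_lin_subproof v).

(* the flow f |-> f + s e^0_m, where e^0_m is the constant function 1 *)
Definition dagger_flow (s : R) (p : total dagger) : total dagger :=
  existT _ (projT1 p) (projT2 p + s *: (affine_one _ : dagger (projT1 p))).

End DaggerBundle.

Section LinearPoisson.
Context {R : realType} {n : nat} {M : manifold R n} {k : nat}.
Variable W : vbundle M k.

(* the fibrewise linear function on W determined by a section of its dual *)
Definition hat (s : forall m, dual_bundle W m) : total W -> R :=
  fun p => (s (projT1 p) : dual _) (projT2 p).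

Definition basic (g : M -> R) : total W -> R := fun p => g (projT1 p).

Definition associated_poisson (A : lie_algebroid (dual_bundle W))
    (L : poisson_tensor (total_atlas W)) : Prop :=
  [/\ forall s1 s2 p, vsmooth s1 -> vsmooth s2 ->
        L (hat s1) (hat s2) p = hat (brk A s1 s2) p,
      forall s g p, vsmooth s -> msmooth g ->
        L (hat s) (basic g) p = anchor A (s (projT1 p)) g &
      forall f g p, msmooth f -> msmooth g -> L (basic f) (basic g) p = 0].

End LinearPoisson.

(* Main.v *)
Require Import Defs.
From HB Require Import structures.
From mathcomp Require Import all_boot all_order all_algebra.
From mathcomp Require Import all_classical all_reals all_analysis.
From mathcomp Require Import ring lra.

Set Implicit Arguments.
Unset Strict Implicit.
Unset Printing Implicit Defensive.

Import Order.TTheory GRing.Theory Num.Theory.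
Import numFieldNormedType.Exports.

Local Open Scope classical_set_scope.
Local Open Scope ring_scope.

(** The constant function 1 is a fibrewise linear function on [bidual E], and
    the image of [can] (resp. [can_lin]) is the hyperplane where it is 1
    (resp. 0).  Along the flow, [hat (can s)] only gains an additive constant,
    so its differential is invariant, while [hat Z], for the bracket Z of
    [can s1] and [can s2], grows with slope Z(1).  Hence the Lie derivative of
    the Poisson tensor, evaluated on the differentials of [hat (can s1)] and
    [hat (can s2)], is Z(1), which gives one direction at once.  Conversely, at
    each point the covectors are spanned by the differentials of functions
    [hat (can s)] and [basic h], all of whose Poisson brackets are invariant
    under the flow when Z(1) = 0 for all s1 and s2.  The spanning needs global
    smooth sections of E through every point, which come from a partition of
    unity. *)

(** * Smooth functions on open subsets of R^n *)

Section CkCalculus.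
Context {R : realType}.

Lemma CkS n k (D : set 'rV[R]_n) f : Ck k.+1 D f -> Ck k D f.
Proof.
elim: k f => [|k IH] f [df cf]; first by move=> x Dx; apply: differentiable_continuous; exact: df.
by split=> // v; apply: IH; exact: cf.
Qed.

Lemma Ck_subset n k (D D' : set 'rV[R]_n) f : D' `<=` D -> Ck k D f -> Ck k D' f.
Proof.
move=> DD; elim: k f => [|k IH] f /=; first by move=> cf x /DD; exact: cf.
by move=> [df cf]; split=> [x /DD|v]; [exact: df|apply: IH].
Qed.

(** The derivative ['D_v f] is formed without reference to the set, so every clause of [Ck] is a
    condition at single points of it. *)
Lemma Ck_local n k (D : set 'rV[R]_n) f :
  (forall x, D x -> exists2 D', D' x & Ck k D' f) -> Ck k D f.
Proof.
elim: k f => [|k IH] f lf /=.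
  by move=> x /lf[D' D'x cf]; exact: (cf x D'x).
split=> [x /lf[D' D'x [df _]]|v]; first exact: df.
by apply: IH => x /lf[D' D'x [_ cf]]; exists D' => //; exact: cf.
Qed.

Lemma Ck_mul n k (D : set 'rV[R]_n) f g : open D ->
  Ck k D f -> Ck k D g -> Ck k D (fun x => f x * g x).
Proof.
move=> oD; elim: k f g => [|k IH] f g.
  by move=> cf cg x Dx; apply: continuousM; [exact: cf|exact: cg].
move=> cf cg; have [df dcf] := cf; have [dg dcg] := cg.
split=> [x Dx|v]; first by apply: differentiableM; [exact: df|exact: dg].
apply: Ck_ext (Ck_add oD (IH _ _ (CkS cf) (dcg v)) (IH _ _ (CkS cg) (dcf v))) => //.
move=> x Dx /=; rewrite -[RHS]/('D_v (f * g) x) deriveM //.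
  by apply: diff_derivable; exact: df.
by apply: diff_derivable; exact: dg.
Qed.

Lemma Ck_sum n k (D : set 'rV[R]_n) (I : Type) (r : seq I)
    (f : I -> 'rV[R]_n -> R) : open D ->
  (forall i, Ck k D (f i)) -> Ck k D (fun x => \sum_(i <- r) f i x).
Proof.
move=> oD cf; elim: r => [|i r IH].
  by under eq_fun do rewrite big_nil; exact: Ck_cst.
by under eq_fun do rewrite big_cons; exact: Ck_add.
Qed.

Lemma derive_coord n (v x : 'rV[R]_n) i :
  'D_v (fun y : 'rV[R]_n => y 0 i : R) x = v 0 i.
Proof.
have := @derive_mx R 'rV[R]_n 1 n id x v (@derivable_id _ _ x v).
by rewrite derive_id => /matrixP /(_ 0 i); rewrite mxE.
Qed.

Lemma Ck_coord n k (D : set 'rV[R]_n) i : Ck k D (fun y => y 0 i).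
Proof.
case: k => [|k] /=.
  by move=> x _; apply: differentiable_continuous; exact: differentiable_coord.
split=> [x _|v]; first exact: differentiable_coord.
rewrite (_ : 'D_v _ = fun=> v 0 i); first exact: Ck_cst.
by apply/funext => x; exact: derive_coord.
Qed.

Lemma differentiable_rV n (V : normedModType R) (phi : V -> 'rV[R]_n) x :
  (forall i, differentiable (fun y => phi y 0 i : R) x) -> differentiable phi x.
Proof.
move=> dphi.
have -> : phi = \sum_(i < n) (fun y => phi y 0 i *: (delta_mx 0 i : 'rV[R]_n)).
  by apply/funext => y; rewrite fct_sumE [LHS]row_sum_delta.
by apply: differentiable_sum => i; exact: differentiableZl.
Qed.

Lemma derive_chain n m (phi : 'rV[R]_n -> 'rV[R]_m) (f : 'rV[R]_m -> R) v x :
  differentiable phi x -> differentiable f (phi x) ->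
  'D_v (f \o phi) x =
    \sum_(i < m) 'D_(delta_mx 0 i) f (phi x) * 'D_v (fun y => phi y 0 i) x.
Proof.
move=> dphi df; rewrite deriveE; last exact: differentiable_comp.
rewrite diff_comp //= -(deriveE _ dphi).
rewrite [X in 'd f _ X]row_sum_delta linear_sum; apply: eq_bigr => i _.
rewrite linearZ /= -deriveE // mulrC; congr (_ * _).
by rewrite derive_mx ?mxE //; exact: diff_derivable.
Qed.

(** Induction on [k] through the chain rule: each ['D_v (f \o phi)] is a sum of products of
    ['D_i f \o phi] with derivatives of the coordinates of [phi]. These coordinates are smooth to
    every order, so only [f] loses a derivative. *)
Lemma Ck_comp n m k (D : set 'rV[R]_n) (D' : set 'rV[R]_m)
    (phi : 'rV[R]_n -> 'rV[R]_m) f : open D ->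
  (forall x, D x -> D' (phi x)) ->
  (forall i, smooth_on D (fun x => phi x 0 i)) -> Ck k D' f -> Ck k D (f \o phi).
Proof.
move=> oD DD' sphi.
have dphi x : D x -> differentiable phi x.
  by move=> Dx; apply: differentiable_rV => i; have [d _] := sphi i 1%N; exact: d.
elim: k f => [|k IH] f cf.
  move=> x Dx; apply: continuous_comp; last exact: (cf _ (DD' _ Dx)).
  by apply: differentiable_continuous; exact: dphi.
have [df dcf] := cf; split=> [x Dx|v].
  by apply: differentiable_comp; [exact: dphi|exact: (df _ (DD' _ Dx))].
apply: (@Ck_ext _ _ _ _ (fun x => \sum_(i < m)
  ('D_(delta_mx 0 i) f \o phi) x * 'D_v (fun y => phi y 0 i) x)) => //.
  by move=> x Dx; rewrite derive_chain //; [exact: dphi|exact: (df _ (DD' _ Dx))].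
apply: Ck_sum => // i; apply: Ck_mul => //; first by apply: (IH ('D_(delta_mx 0 i) f)); exact: dcf.
by have [_ cd] := sphi i k.+1; exact: cd.
Qed.

(** The derivative of [1/f] is [- (1/f)^2 'D_v f], which involves only [1/f] itself and a derivative
    of [f], so the induction closes. *)
Lemma Ck_inv n k (D : set 'rV[R]_n) f : open D ->
  (forall x, D x -> f x != 0) -> Ck k D f -> Ck k D (fun x => (f x)^-1).
Proof.
move=> oD f0; elim: k => [|k IH] cf.
  by move=> x Dx; apply: continuousV; [exact: f0|exact: cf].
have [df dcf] := cf; split=> [x Dx|v].
  by apply: differentiableV; [exact: df|exact: f0].
apply: (@Ck_ext _ _ _ _ (fun x => -1 * ((f x)^-1 * (f x)^-1 * 'D_v f x))) => //.
  move=> x Dx; rewrite [RHS]deriveV ?f0 //; last by apply: diff_derivable; exact: df.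
  by rewrite mulN1r scaleNr -exprVn expr2.
apply: Ck_scale => //; apply: Ck_mul => //; last exact: dcf.
by apply: Ck_mul => //; exact: IH (CkS cf).
Qed.

End CkCalculus.

(** * A smooth function on the line that vanishes for [t <= 0] *)

Section Flat.
Context {R : realType}.

(* The factor [t^-n] makes the family closed under differentiation. *)
Definition flat (n : nat) (t : R) : R :=
  if 0 < t then t^-1 ^+ n * expR (- t^-1) else 0.

(** With [u = 1/t], one term of the exponential series gives [u^(n+2) / (n+2)! <= e^u]. The bound is
    quadratic so that the difference quotient at 0 tends to 0. *)
Lemma flat_le n (t : R) : `|flat n t| <= (n.+2)`!%:R * t ^+ 2.
Proof.
rewrite /flat; case: ifPn => t0; last by rewrite normr0 mulr_ge0 // sqr_ge0.
have u0 : 0 < t^-1 by rewrite invr_gt0.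
rewrite ger0_norm; last by rewrite mulr_ge0 ?expR_ge0 // exprn_ge0 // ltW.
have := expR_ge1Dxn n.+1 (ltW u0) => /(le_trans _) h.
have {}h : t^-1 ^+ n.+2 / (n.+2)`!%:R <= expR t^-1 by apply: h; rewrite lerDr.
rewrite expRN ler_pdivrMr ?expR_gt0 //.
rewrite -ler_pdivrMl ?mulr_gt0 ?ltr0n ?fact_gt0 ?exprn_gt0 //.
apply: le_trans h; rewrite le_eqVlt; apply/orP; left; apply/eqP.
rewrite invfM -exprVn -[n.+2]addn2 exprD.
by rewrite addn2; ring.
Qed.

Lemma is_derive_flat n (t : R) :
  is_derive t (1 : R) (flat n) (flat n.+2 t - n%:R * flat n.+1 t).
Proof.
case: (ltgtP t 0) => [t0|t0|->].
- have -> : flat n.+2 t - n%:R * flat n.+1 t = 0.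
    by rewrite /flat ltNge (ltW t0) mulr0 subr0.
  apply: near_eq_is_derive (is_derive_cst (0 : R) t 1).
  have : \forall s \near t, s < 0 by exact: lt_nbhsl.
  by apply: filterS => s s0; rewrite /flat ltNge (ltW s0).
- have tn0 : t != 0 by exact: lt0r_neq0.
  apply: (@near_eq_is_derive R R^o R^o (fun s : R => s^-1 ^+ n * expR (- s^-1))).
    have : \forall s \near t, 0 < s by exact: lt_nbhsr.
    by apply: filterS => s s0; rewrite /flat s0.
  have dV : is_derive t (1 : R) (fun s : R => s^-1) (- t ^- 2).
    by apply: is_derive_eq; first exact: is_deriveV; rewrite /GRing.scale /= mulr1.
  have dE : is_derive t (1 : R) (fun s : R => expR (- s^-1)) (expR (- t^-1) * - - t ^- 2).
    exact: (@is_derive1_comp _ expR (fun s : R => - s^-1)).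
  have dX : is_derive t (1 : R) (fun s : R => s^-1 ^+ n) (n%:R * t^-1 ^+ n.-1 * - t ^- 2).
    rewrite (_ : (fun s : R => _) = (fun s : R => s^-1) ^+ n).
      exact: (is_deriveX n dV).
    by apply/funext => s; rewrite exprfctE.
  apply: is_derive_eq; rewrite /GRing.scale /= /flat t0 opprK.
  (* The power rule produced the exponent [n.-1], hence the separate case [n = 0]. *)
  by case: (n) => [|m]; rewrite ?exprS ?expr0 /=; field.
- have -> : flat n.+2 0 - n%:R * flat n.+1 0 = 0 :> R.
    by rewrite /flat ltxx mulr0 subr0.
  (* By [flat_le] the difference quotient at 0 is at most [(n+2)! |h|] in absolute value. *)
  have c0 : h^-1 *: ((flat n \o shift (0 : R)) (h *: (1 : R)) - flat n (0 : R))
      @[h --> 0^'] --> (0 : R).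
    have n0 : 0 < (n.+2)`!%:R :> R by rewrite ltr0n fact_gt0.
    apply/cvgr0Pnorm_le => e e0; near=> h.
    have hn0 : h != 0 by near: h; exact: nbhs_dnbhs_neq.
    have fl0 : flat n 0 = 0 :> R by rewrite /flat ltxx.
    rewrite /= fl0 subr0 addr0 /GRing.scale /= mulr1 normrM normfV.
    rewrite ler_pdivrMl ?normr_gt0 //; apply: le_trans (flat_le n h) _.
    rewrite -(real_normK (num_real h)) expr2 mulrCA ler_pM2l ?normr_gt0 //.
    rewrite -ler_pdivlMl // mulrC.
    by near: h; apply: dnbhs0_le; rewrite divr_gt0.
  by apply: DeriveDef; [apply: cvgP c0|apply: cvg_lim c0].
Unshelve. all: by end_near. Qed.

Lemma Ck_flat n k (D : set 'rV[R]_n) f a : open D ->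
  Ck k D f -> Ck k D (flat a \o f).
Proof.
move=> oD.
have dflat b t : differentiable (flat b) t.
  by apply/derivable1_diffP; case: (is_derive_flat b t).
(* The index [a] stays general, since differentiating raises it to [a.+1] and [a.+2]. *)
elim: k f a => [|k IH] f a cf.
  move=> x Dx; apply: continuous_comp; first exact: (cf _ Dx).
  exact: differentiable_continuous.
have [df dcf] := cf; split=> [x Dx|v].
  by apply: differentiable_comp; [exact: df|exact: dflat].
apply: (@Ck_ext _ _ _ _ (fun x =>
  (flat a.+2 (f x) + (- a%:R) * flat a.+1 (f x)) * 'D_v f x)) => //.
  move=> x Dx; rewrite [RHS]deriveE; last by apply: differentiable_comp; [exact: df|exact: dflat].
  rewrite diff_comp //=; last exact: df.
  rewrite -(deriveE _ (df _ Dx)) -[X in 'd _ _ X]mulr1 -[_ * 1]/(_ *: 1) linearZ /=.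
  by rewrite -deriveE // (@derive_val _ _ _ _ _ _ _ (is_derive_flat a (f x))) mulNr mulrC.
apply: Ck_mul => //; last exact: dcf.
apply: Ck_add => //; last apply: Ck_scale => //.
  exact: (IH f a.+2 (CkS cf)).
exact: (IH f a.+1 (CkS cf)).
Qed.

End Flat.

(** * Smooth functions on a manifold *)

Section ManifoldSmooth.
Context {R : realType} {n : nat} {M : manifold R n}.
Implicit Types (U : set M) (f g : M -> R).

Lemma msmooth_on_subset U U' f : U' `<=` U -> msmooth_on U f -> msmooth_on U' f.
Proof.
move=> UU sf c Ac k; apply: Ck_subset (sf c Ac k).
by apply: image_subset => p [cp /UU].
Qed.

Lemma msmooth_on_local U f :
  (forall p, U p -> exists2 U', U' p & msmooth_on U' f) -> msmooth_on U f.
Proof.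
move=> lf c Ac k; apply: Ck_local => _ [p [cp /lf[U' U'p sf]] <-].
by exists (cmap c @` (cdom c `&` U')); [exists p|exact: sf].
Qed.

Lemma msmooth_on_ext U f g : open U ->
  (forall p, U p -> f p = g p) -> msmooth_on U f -> msmooth_on U g.
Proof.
move=> oU fg sf c Ac k; apply: Ck_ext (sf c Ac k); first exact: chart_im_open.
by move=> _ [p [cp Up] <-] /=; rewrite m_cancel // fg.
Qed.

Lemma msmooth_on_cst U (a : R) : msmooth_on U (fun=> a).
Proof. by move=> c Ac k; exact: Ck_cst. Qed.

Lemma msmooth_on_add U f g : open U ->
  msmooth_on U f -> msmooth_on U g -> msmooth_on U (fun p => f p + g p).
Proof.
move=> oU sf sg c Ac k.
exact: (Ck_add (chart_im_open Ac oU) (sf c Ac k) (sg c Ac k)).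
Qed.

Lemma msmooth_on_mul U f g : open U ->
  msmooth_on U f -> msmooth_on U g -> msmooth_on U (fun p => f p * g p).
Proof.
move=> oU sf sg c Ac k.
exact: (Ck_mul (chart_im_open Ac oU) (sf c Ac k) (sg c Ac k)).
Qed.

Lemma msmooth_on_sum U (I : Type) (r : seq I) (f : I -> M -> R) : open U ->
  (forall i, msmooth_on U (f i)) -> msmooth_on U (fun p => \sum_(i <- r) f i p).
Proof.
move=> oU sf c Ac k.
exact: (Ck_sum r (chart_im_open Ac oU) (fun i => sf i c Ac k)).
Qed.

Lemma msmooth_on_prod U (I : Type) (r : seq I) (f : I -> M -> R) : open U ->
  (forall i, msmooth_on U (f i)) -> msmooth_on U (fun p => \prod_(i <- r) f i p).
Proof.
move=> oU sf; elim: r => [|i r IH].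
  by under eq_fun do rewrite big_nil; exact: msmooth_on_cst.
by under eq_fun do rewrite big_cons; exact: msmooth_on_mul.
Qed.

(** Read in another chart [c'], the function is [F] composed with the transition map from [c'] to
    [c]. *)
Lemma msmooth_on_cmap U (c : chart R n M) (D : set 'rV[R]_n) (F : 'rV[R]_n -> R) :
  matlas c -> open U -> U `<=` cdom c -> (forall p, U p -> D (cmap c p)) ->
  smooth_on D F -> msmooth_on U (F \o cmap c).
Proof.
move=> Ac oU Uc UD sF c' Ac' k.
apply: (@Ck_comp _ _ _ _ _ D (cmap c \o cinv c')) => //.
- exact: chart_im_open.
- by move=> _ [p [cp Up] <-] /=; rewrite m_cancel //; exact: UD.
- move=> j l; apply: Ck_subset (m_transition j Ac' Ac l).
  by apply: image_subset => p [cp /Uc].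
Qed.

(* No value of [g] outside [U] matters, as [rho] vanishes there. *)
Lemma msmooth_on_cutoff (T U K : set M) (rho g : M -> R) :
  open T -> open U -> closed K -> K `<=` U ->
  (forall p, ~ K p -> rho p = 0) -> msmooth_on T rho ->
  msmooth_on (T `&` U) g -> msmooth_on T (fun p => rho p * g p).
Proof.
move=> oT oU cK KU rho0 srho sg; apply: msmooth_on_local => p Tp.
have [Kp|nKp] := pselect (K p).
  exists (T `&` U); first by split=> //; exact: KU.
  apply: msmooth_on_mul => //; first exact: openI.
  by apply: msmooth_on_subset srho => q [].
exists (~` K) => //; apply: (@msmooth_on_ext _ (fun=> 0)) (msmooth_on_cst _ _).
  exact: closed_openC.
by move=> q nKq; rewrite rho0 // mul0r.
Qed.

Lemma box_nbhs (x : 'rV[R]_n) (W : set 'rV[R]_n) : nbhs x W ->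
  exists2 d : R, 0 < d & forall y : 'rV[R]_n, (forall i, `|y 0 i - x 0 i| <= 2 * d) -> W y.
Proof.
(* With [d = e / 4] the closed box of half-width [2 * d = e / 2] lies in the sup-norm ball of radius
   [e]. *)
move=> /nbhs_ballP[e /= e0 xW]; exists (e / 4); first by rewrite divr_gt0.
move=> y xy; apply: xW; split=> // i j; rewrite ord1 /ball /= distrC.
apply: le_lt_trans (xy j) _; lra.
Qed.

Lemma compact_box (x : 'rV[R]_n) (d : R) :
  compact [set y : 'rV[R]_n | forall i, `|y 0 i - x 0 i| <= d].
Proof.
rewrite (_ : mkset _ = [set y : 'rV[R]_n | forall i,
    `[x 0 i - d, x 0 i + d]%classic (y ord0 i)]).
  apply: (@rV_compact R n (fun i => `[x 0 i - d, x 0 i + d]%classic)) => i.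
  exact: segment_compact.
apply/seteqP; split=> y /= h i; have := h i; rewrite in_itv /= ler_norml; lra.
Qed.

(** With [r = |y - x|^2 / d^2], the quotient [N / (N + P)] is 1 where [r <= 1] and 0 where [r >= 2].
    Its denominator is positive because [2 - r] and [r - 1] are never both nonpositive. Outside the
    box one coordinate alone forces [r >= 2]. *)
Lemma smooth_box_bump (x : 'rV[R]_n) (d : R) : 0 < d ->
  exists b : 'rV[R]_n -> R, [/\ smooth_on setT b,
    forall y : 'rV[R]_n, ~ (forall i, `|y 0 i - x 0 i| <= 2 * d) -> b y = 0 &
    \forall y \near x, b y = 1].
Proof.
move=> d0; pose q (y : 'rV[R]_n) : R := \sum_i (y 0 i - x 0 i) * (y 0 i - x 0 i).
pose r y := d ^- 2 * q y; pose N y := flat 0 (2 + -1 * r y).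
pose P y := flat 0 (-1 + r y).
have sr k : Ck k setT r.
  apply: Ck_scale; first exact: openT.
  have sd i : Ck k setT (fun y : 'rV[R]_n => y 0 i - x 0 i).
    by apply: Ck_add; [exact: openT|exact: Ck_coord|exact: Ck_cst].
  by apply: Ck_sum => [|i]; [exact: openT|apply: Ck_mul => //; exact: openT].
have sN k : Ck k setT N.
  apply: (@Ck_flat _ _ _ _ (fun y => 2 + -1 * r y)); first exact: openT.
  by apply: Ck_add; [exact: openT|exact: Ck_cst|apply: Ck_scale => //; exact: openT].
have sP k : Ck k setT P.
  apply: (@Ck_flat _ _ _ _ (fun y => -1 + r y)); first exact: openT.
  by apply: Ck_add => //; [exact: openT|exact: Ck_cst].
have flat_gt0 t : 0 < t -> 0 < flat 0 t :> R.
  by move=> t0; rewrite /flat t0 expr0 mul1r expR_gt0.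
have flat_eq0 t : t <= 0 -> flat 0 t = 0 :> R by rewrite /flat ltNge => ->.
have flat_ge0 t : 0 <= flat 0 t :> R.
  by case: (ltP 0 t) => [/flat_gt0/ltW//|/flat_eq0 ->].
have NP y : N y + P y != 0.
  apply: lt0r_neq0; have [r2|r2] := ltP (r y) 2.
    by apply: ltr_wpDr; [exact: flat_ge0|apply: flat_gt0; lra].
  by apply: ltr_wpDl; [exact: flat_ge0|apply: flat_gt0; lra].
exists (fun y => N y * (N y + P y)^-1); split.
- move=> k; apply: Ck_mul => //; first exact: openT.
  by apply: Ck_inv => //; [exact: openT|apply: Ck_add => //; exact: openT].
- move=> y /existsNP[i /negP]; rewrite -ltNge => di.
  rewrite {1}/N flat_eq0 ?mul0r //.
  suff : 2 <= r y by lra.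
  rewrite /r ler_pdivlMl ?exprn_gt0 // /q (bigD1 i) //= -expr2 -(real_normK (num_real (y 0 i - x 0 i))).
  have s0 : 0 <= \sum_(j < n | j != i) (y 0 j - x 0 j) * (y 0 j - x 0 j).
    by apply: sumr_ge0 => j _; rewrite -expr2 sqr_ge0.
  have h : 2 * d * (2 * d) <= `|y 0 i - x 0 i| * `|y 0 i - x 0 i| by apply: ler_pM; lra.
  have dd : 0 <= d * d by rewrite mulr_ge0 // ltW.
  rewrite !expr2; lra.
- have cr : {for x, continuous r} by exact: (sr 0%N x I).
  have rx : r x = 0 by rewrite /r /q big1 ?mulr0 // => i _; rewrite subrr mulr0.
  have : \forall y \near x, r y < 1.
    apply: (cr (fun t => t < 1)); rewrite /= rx; apply: lt_nbhsl; exact: ltr01.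
  apply: filterS => y y1; rewrite /P flat_eq0 ?addr0 ?divff //; last lra.
  by apply: lt0r_neq0; apply: flat_gt0; lra.
Qed.

Lemma bump_function (m : M) U : open U -> U m ->
  exists (rho : M -> R) (K : set M), [/\ msmooth rho, closed K, K `<=` U,
    forall p, ~ K p -> rho p = 0 & \forall p \near m, rho p = 1].
Proof.
move=> oU Um; have [c Ac cm] := m_cover m.
set W := cmap c @` (cdom c `&` U); have oW : open W by exact: chart_im_open.
have : nbhs (cmap c m) W by apply: open_nbhs_nbhs; split => //; exists m.
move=> /box_nbhs[d d0 dW]; have [b [sb b0 b1]] := smooth_box_bump (cmap c m) d0.
set B := [set y : 'rV[R]_n | forall i, `|y 0 i - cmap c m 0 i| <= 2 * d].
set K := cinv c @` B.
have BW : B `<=` W by move=> y; exact: dW.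
have KU : K `<=` cdom c `&` U.
  by move=> _ [y /BW[p [cp Up] <-] <-]; rewrite m_cancel.
have cK : closed K.
  apply: compact_closed; first exact: m_hausdorff.
  apply: continuous_compact; last exact: compact_box.
  apply: continuous_in_subspaceT => y /set_mem /BW[p [cp _] yE].
  by apply: (m_cinv_continuous Ac); exists p.
pose rho p := if pselect (K p) then b (cmap c p) else 0.
have rhoE p : (cdom c `&` U) p -> rho p = b (cmap c p).
  move=> [cp Up]; rewrite /rho; case: pselect => // nKp; rewrite b0 // => Bp.
  by apply: nKp; exists (cmap c p) => //; rewrite m_cancel.
have rho0 p : ~ K p -> rho p = 0 by rewrite /rho; case: pselect.
have ocU : open (cdom c `&` U) by apply: openI => //; exact: m_dom_open.
exists rho, K; split => //; last 1 first.
- have : \forall p \near m, b (cmap c p) = 1 by have h := m_cmap_continuous Ac cm; exact: (h (fun y => b y = 1) b1).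
  have : nbhs m (cdom c `&` U) by exact: open_nbhs_nbhs.
  by apply: filterS2 => p /rhoE ->.
- apply: msmooth_on_local => p _; have [Kp|nKp] := pselect (K p).
    exists (cdom c `&` U); first exact: KU.
    apply: (@msmooth_on_ext _ (b \o cmap c)) => //.
      by move=> q /rhoE ->.
    by apply: (@msmooth_on_cmap _ c setT) => // q [].
  exists (~` K) => //; apply: (@msmooth_on_ext _ (fun=> 0)) (msmooth_on_cst _ _).
    exact: closed_openC.
  by move=> q /rho0.
- by move=> p /KU[].
Qed.

Lemma msmooth_extend (m : M) U f : open U -> U m -> msmooth_on U f ->
  exists2 g, msmooth g & \forall p \near m, g p = f p.
Proof.
move=> oU Um sf; have [rho [K [srho cK KU rho0 rho1]]] := bump_function oU Um.
exists (fun p => rho p * f p).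
  by apply: (msmooth_on_cutoff (K := K) (U := U)) => //; [exact: openT|rewrite setTI].
by apply: filterS rho1 => p ->; rewrite mul1r.
Qed.

(** Each point lies in a basic open set contained in some [O m]; one such [m] is chosen for every
    member of a countable basis that has one. Placing [m0] first gives it the first weight of the
    partition of unity. *)
Lemma countable_subcover (O : M -> set M) (m0 : M) : (forall m, nbhs m (O m)) ->
  exists e : nat -> M, e 0%N = m0 /\ forall p, exists j, O (e j) p.
Proof.
move=> nO; have [B /pfcard_geP cB [oB bB]] := m_countable M.
have BO p : exists2 b, B b /\ b p & b `<=` O p by have [b] := bB p _ (nO p); exists b.
case: cB => [B0|/unsquash h].
  by have [b [Bb _] _] := BO m0; rewrite B0 in Bb.
pose P (j : nat) m := h j `<=` O m.
pose e' j := if pselect (exists m, P j m) is left w then sval (cid w) else m0.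
exists (fun j => if j is j'.+1 then e' j' else m0); split => // p.
have [b [Bb bp] bO] := BO p; have [j _ jb] : range h b by rewrite image_eq.
exists j.+1; rewrite /= /e'; case: pselect => [w|[]]; last first.
  by exists p; rewrite /P jb.
by case: cid => m /= Pm; apply: Pm; rewrite jb.
Qed.

End ManifoldSmooth.

(** * Sections of an affine bundle *)

Section AffineSections.
Context {R : realType} {n : nat} {M : manifold R n} {k : nat} {V : vbundle M k}.
Variable E : affbundle V.

Definition adiff m (x y : E m) : V m := sval (cid (act_torsor y x)).

Lemma act_adiff m (x y : E m) : act y (adiff x y) = x.
Proof. by rewrite /adiff; case: cid => v []. Qed.

(** The base point contributes [tmap t o] with total coefficient [\sum_i a i = 1] on both sides, so
    the coordinates of the combination do not depend on [o]. *)
Lemma affine_comb (t : triv R k (afib E)) m (o : E m) N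
    (a : 'I_N -> R) (x : 'I_N -> E m) :
  aatlas t -> tdom t m -> \sum_i a i = 1 ->
  tmap t (act o (\sum_i a i *: adiff (x i) o)) = \sum_i a i *: tmap t (x i).
Proof.
move=> At tm a1; have [L tL] := a_affine At tm.
have xE i : tmap t (x i) = tmap t o + L (adiff (x i) o) by rewrite -tL act_adiff.
rewrite tL linear_sum; under [RHS]eq_bigr do rewrite xE scalerDr.
rewrite big_split /= -scaler_suml a1 scale1r; congr (_ + _).
by apply: eq_bigr => i _; rewrite linearZ.
Qed.

Section Partition.
Variable rho : nat -> M -> R.

(* The weights [rho j * prod_(i < j) (1 - rho i)] add up to 1 as soon as some
   [rho i] is 1, and then all later weights vanish: where the sets on which
   [rho i = 1] have interiors covering M, this is a locally finite partition of
   unity. *)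
Definition defect j p := \prod_(i < j) (1 - rho i p).

Definition weight j p := defect j p * rho j p.

Lemma sum_weight N p : \sum_(i < N) weight i p = 1 - defect N p.
Proof.
elim: N => [|N IH]; first by rewrite big_ord0 /defect big_ord0 subrr.
rewrite big_ord_recr /= IH {2}/defect big_ord_recr /= -/(defect N p) /weight.
ring.
Qed.

Lemma defect_eq0 N N' p : (N <= N')%N -> defect N p = 0 -> defect N' p = 0.
Proof.
move=> /subnKC <-; elim: (N' - N)%N => [|i IH]; first by rewrite addn0.
by move=> /IH; rewrite addnS {2}/defect big_ord_recr /= -/(defect _ p) => ->; rewrite mul0r.
Qed.

Lemma defectS_eq0 j p : rho j p = 1 -> defect j.+1 p = 0.
Proof. by move=> r1; rewrite /defect big_ord_recr /= r1 subrr mulr0. Qed.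

(** A vanishing defect kills all weights from that index on. The length of the sum, chosen point by
    point in [asmooth_through], can thus be exchanged for one valid on a whole neighbourhood. *)
Lemma sum_weight_eq (W : lmodType R) (F : nat -> W) N N' p :
  defect N p = 0 -> defect N' p = 0 ->
  \sum_(i < N) weight i p *: F i = \sum_(i < N') weight i p *: F i.
Proof.
wlog le : N N' / (N <= N')%N => [H d d'|d _].
  by have [/H|/ltnW/H] := leqP N N' => [|e]; [exact|apply/esym/e].
rewrite (big_ord_widen _ (fun i => weight i p *: F i) le) big_mkcond /=.
apply: eq_bigr => i _; case: ltnP => // Ni.
by rewrite /weight (defect_eq0 Ni d) mul0r scale0r.
Qed.

End Partition.

(** Local sections with constant coordinates are glued by affine combinations whose weights come
    from the bump functions. *)
Lemma asmooth_through m0 (x0 : E m0) : exists s, asmooth s /\ s m0 = x0.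
Proof.
have /choice[D HD] p : exists d : triv R k (afib E) * (M -> R) * set M,
    [/\ aatlas d.1.1 /\ tdom d.1.1 p, msmooth d.1.2,
        closed d.2 /\ d.2 `<=` tdom d.1.1,
        forall q, ~ d.2 q -> d.1.2 q = 0 &
        \forall q \near p, d.1.2 q = 1].
  have [t At tp] := a_cover E p.
  by have [rho [K [? ? ? ? ?]]] := bump_function (a_open At) tp; exists (t, rho, K).
have [e [e0 eO]] : exists e : nat -> M, e 0%N = m0 /\
    forall p, exists j, ((D (e j)).1.2 @^-1` [set 1])^° p.
  apply: (countable_subcover (O := fun q => ((D q).1.2 @^-1` [set 1])^°)) => p.
  apply: nbhs_interior.
  by have [] := HD p.
pose rho j := (D (e j)).1.2; pose t j := (D (e j)).1.1.
have tm0 : tdom (t 0%N) m0 by have [[_ +] _ _ _ _] := HD (e 0%N); rewrite /t e0.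
have At j : aatlas (t j) by have [[]] := HD (e j).
have srho j : msmooth (rho j) by have [] := HD (e j).
(* All coordinates are those of [x0] in [t 0], so [sigma 0 m0 = x0]. Off [tdom (t j)] the value is
   arbitrary, but [rho j] vanishes there. *)
pose sigma j p : E p := tinv (t j) p (tmap (t 0%N) x0).
have nN (p : M) : exists N, \forall q \near p, defect rho N q = 0.
  have [j pj] := eO p; exists j.+1; have : nbhs p (rho j @^-1` [set 1]) by exact: pj.
  by apply: filterS => q; exact: defectS_eq0.
have [N HN] := choice nN.
have N0 p : defect rho (N p) p = 0 by exact: nbhs_singleton (HN p).
(* This choice need not be continuous in [p]; by [affine_comb] it drops out of the coordinates. *)
have o p : E p.
  by have [u _ _] := cid2 (a_cover E p); exact: (tinv u p 0).
pose s p := act (o p) (\sum_(i < N p) weight rho i p *: adiff (sigma i p) (o p)).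
have sE u p j : aatlas u -> tdom u p -> defect rho j p = 0 ->
    tmap u (s p) = \sum_(i < j) weight rho i p *: tmap u (sigma i p).
  move=> Au up d0.
  rewrite affine_comb //; last by rewrite sum_weight N0 subr0.
  exact: (sum_weight_eq (fun i => tmap u (sigma i p))).
exists s; split; last first.
  apply: (can_inj (a_tmapK (At 0%N) tm0)).
  have r1 : rho 0%N m0 = 1.
    by have [_ _ _ _ h] := HD m0; rewrite /rho e0; exact: nbhs_singleton h.
  (* As [rho 0] is 1 at [m0], the first term alone survives there, with weight 1. *)
  rewrite (sE _ _ 1%N) //; last exact: defectS_eq0.
  rewrite big_ord_recl big_ord0 addr0 /weight /defect big_ord0 mul1r r1 scale1r.
  by rewrite a_tinvK.
move=> u j Au; apply: msmooth_on_local => p up.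
have /nbhs_interior := HN p; set O := [set q | _]^° => Op.
have oO : open O by exact: open_interior.
have ou := a_open Au; have ouO : open (tdom u `&` O) by exact: openI.
exists (tdom u `&` O); first by split => //; exact: nbhs_singleton.
(* The factor [rho i] is pulled out of the weight: the coordinates of [sigma i] are smooth only over
   [tdom (t i)], and [rho i] vanishes off a closed subset of it. *)
apply: (@msmooth_on_ext _ _ _ _ (fun q => \sum_(i < N p)
    rho i q * (defect rho i q * tmap u (sigma i q) 0 j))) => //.
  move=> q [uq /interior_subset Oq]; rewrite (sE _ _ (N p)) // summxE.
  by apply: eq_bigr => i _; rewrite mxE mulrA (mulrC (rho i q)).
apply: msmooth_on_subset (_ : msmooth_on (tdom u) _); first by move=> q [].
apply: msmooth_on_sum => // i.
have [_ _ [cK KU] rho0 _] := HD (e i).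
apply: (msmooth_on_cutoff (K := (D (e i)).2) (U := tdom (t i))) => //.
- exact: a_open.
- exact: msmooth_on_subset (srho i).
have out : open (tdom u `&` tdom (t i)) by apply: openI => //; exact: a_open.
apply: msmooth_on_mul => //.
  apply: msmooth_on_prod => // l.
  have -> : (fun q => 1 - rho l q) = (fun q => 1 + -1 * rho l q).
    by apply/funext => q; rewrite mulN1r.
  apply: msmooth_on_add => //; first exact: msmooth_on_cst.
  apply: msmooth_on_mul => //; first exact: msmooth_on_cst.
  exact: msmooth_on_subset (srho l).
by rewrite setIC; exact: a_transition.
Qed.

End AffineSections.

(** * The total space of a vector bundle *)

(** A directional derivative sees only the restriction to a line. Letting the domains differ allows
    derivatives in a chart of the total space to be compared with derivatives in a chart of M. *)
Lemma eq_derive_line {R : realType} (U U' W : normedModType R) (f : U -> W) (f' : U' -> W)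
    a v a' v' : (forall h : R, f (h *: v + a) = f' (h *: v' + a')) ->
  'D_v f a = 'D_v' f' a'.
Proof.
move=> ff'; rewrite /derive.
have fa : f a = f' a' by have := ff' 0; rewrite !scale0r !add0r.
rewrite (_ : (fun h => h^-1 *: ((f \o shift a) (h *: v) - f a)) =
  (fun h => h^-1 *: ((f' \o shift a') (h *: v') - f' a'))) //.
by apply/funext => h; rewrite /= ff' fa.
Qed.

Section TotalSpace.
Context {R : realType} {n : nat} {M : manifold R n} {k : nat}.
Variable W : vbundle M k.
Variables (c : chart R n M) (t : triv R k (vfib W)).
Hypotheses (Ac : matlas c) (At : vatlas t).
Let C := total_chart c t.

Lemma total_cancel p : cdom C p -> cinv C (cmap C p) = p.
Proof.
case: p => m w [/= cm tm]; rewrite row_mxKl row_mxKr.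
by rewrite m_cancel // v_tmapK.
Qed.

Lemma total_cmap_cinv m y : cdom c m -> tdom t m ->
  cmap C (existT _ m (tinv t m y)) = row_mx (cmap c m) y.
Proof. by move=> cm tm; rewrite /= v_tinvK. Qed.

Lemma total_imE : cmap C @` cdom C = lsubmx @^-1` (cmap c @` (cdom c `&` tdom t)).
Proof.
apply/seteqP; split=> [_ [[m w] [/= cm tm] <-]|z [m [cm tm] mz]].
  by exists m => //; rewrite row_mxKl.
exists (existT _ m (tinv t m (rsubmx z))) => //.
by rewrite total_cmap_cinv // mz hsubmxK.
Qed.

Lemma total_im_open : open (cmap C @` cdom C).
Proof.
rewrite total_imE; apply: open_comp; first by move=> z _; exact: continuous_lsubmx.
by apply: chart_im_open => //; exact: v_open.
Qed.

Lemma smooth_on_total_im (f : M -> R) (F : 'rV[R]_(n + k) -> R) :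
  msmooth_on (tdom t) f ->
  (forall z, (cmap C @` cdom C) z -> F z = f (cinv c (lsubmx z))) ->
  smooth_on (cmap C @` cdom C) F.
Proof.
move=> sf FE l; apply: (@Ck_ext _ _ _ _ ((f \o cinv c) \o lsubmx)).
- exact: total_im_open.
- by move=> z /FE.
apply: (@Ck_comp _ _ _ _ _ (cmap c @` (cdom c `&` tdom t))).
- exact: total_im_open.
- by move=> z; rewrite total_imE.
- move=> i l'; apply: (@Ck_ext _ _ _ _ (fun z : 'rV[R]_(n + k) => z 0 (lshift k i))).
  + exact: total_im_open.
  + by move=> z _; rewrite mxE.
  + exact: Ck_coord.
- exact: sf.
Qed.

Lemma hat_total_chart (s : forall m, dual_bundle W m) z : (cmap C @` cdom C) z ->
  hat s (cinv C z) = \sum_i z 0 (rshift n i) *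
    tmap (dual_triv t) (s (cinv c (lsubmx z))) 0 i.
Proof.
rewrite total_imE => -[m [cm tm] mz]; rewrite /hat /= -mz m_cancel //.
rewrite dual_form_tinv //; apply: eq_bigr => i _.
by rewrite !mxE.
Qed.

Lemma pderiv_basic_base (h : M -> R) p i : cdom C p ->
  pderiv C (lshift k i) (basic h) p = pderiv c i h (projT1 p).
Proof.
case: p => m w [/= cm tm]; apply: eq_derive_line => r /=.
rewrite /basic /= linearD linearZ /= row_mxKl.
congr (h (cinv c (_ *: _ + _))).
by apply/rowP => j; rewrite !mxE /= (inj_eq (@lshift_inj _ _)).
Qed.

Lemma pderiv_basic_fibre (h : M -> R) p a : cdom C p ->
  pderiv C (rshift n a) (basic h) p = 0.
Proof.
(* A fibre direction projects to 0 in the base chart. *)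
case: p => m w [/= cm tm]; rewrite -[RHS](derive0 (h \o cinv c) (cmap c m)).
apply: eq_derive_line => r /=.
rewrite /basic /= linearD linearZ /= row_mxKl.
congr (h (cinv c (_ *: _ + _))).
by apply/rowP => j; rewrite !mxE /= eq_lrshift.
Qed.

Lemma pderiv_hat_fibre (s : forall m, dual_bundle W m) p a : cdom C p ->
  pderiv C (rshift n a) (hat s) p =
    (s (projT1 p) : dual _) (tinv t (projT1 p) (delta_mx 0 a)).
Proof.
case: p => m w [/= cm tm]; rewrite /pderiv /derive.
(* By fibrewise linearity the difference quotient is constant in [r != 0]. *)
set l : R := RHS; apply: (@lim_near_cst R) => //; near=> r; rewrite {}/l.
have r0 : r != 0 by near: r; exact: nbhs_dnbhs_neq.
have dl : lsubmx (delta_mx 0 (rshift n a) : 'rV[R]_(n + k)) = 0.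
  by apply/rowP => j; rewrite !mxE /= eq_lrshift.
have dr : rsubmx (delta_mx 0 (rshift n a) : 'rV[R]_(n + k)) = delta_mx 0 a.
  by apply/rowP => j; rewrite !mxE /= (inj_eq (@rshift_inj _ _)).
rewrite /hat /= !linearD !linearZ /= dl dr scaler0 add0r !row_mxKl !row_mxKr.
rewrite m_cancel // tinv_linear // linearP -scalerDr addrK.
by rewrite scalerA mulVf // scale1r.
Unshelve. all: by end_near. Qed.

End TotalSpace.

Section TotalSmooth.
Context {R : realType} {n : nat} {M : manifold R n} {k : nat}.
Variable W : vbundle M k.

Lemma csmooth_hat (s : forall m, dual_bundle W m) : vsmooth s ->
  csmooth (total_atlas W) (hat s).
Proof.
move=> ss _ [c [t [Ac At ->]]] l; rewrite setIT.
have oD := total_im_open Ac At.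
apply: (@Ck_ext _ _ _ _ _ _ oD (fun z Dz => esym (hat_total_chart Ac At s Dz))).
apply: Ck_sum => // i; apply: Ck_mul => //; first exact: Ck_coord.
apply: (smooth_on_total_im Ac At (f := fun m => tmap (dual_triv t) (s m) 0 i)) => //.
by apply: (ss (dual_triv t) i); exists t.
Qed.

Lemma csmooth_basic (h : M -> R) : msmooth h -> csmooth (total_atlas W) (basic h).
Proof.
move=> sh _ [c [t [Ac At ->]]]; rewrite setIT.
apply: (smooth_on_total_im Ac At (f := h)) => //.
exact: msmooth_on_subset sh.
Qed.

End TotalSmooth.

(** * The flow of [d/dmu_0] in the charts of the dual bundle *)

Section Flow.
Context {R : realType} {n : nat} {M : manifold R n} {k : nat} {V : vbundle M k}.
Variable E : affbundle V.

Lemma dagger_flowK s p : dagger_flow (E := E) (- s) (dagger_flow s p) = p.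
Proof.
by case: p => m w; rewrite /dagger_flow /= -addrA -scalerDl subrr scale0r addr0.
Qed.

Lemma hat_flow (z : forall m, bidual E m) s p :
  hat z (dagger_flow s p) =
    hat z p + s * (z (projT1 p) : dual _) (affine_one _ : dagger E _).
Proof. by rewrite /hat /= linearD linearZ. Qed.

(** The coordinate vector of [d/dmu_0]: in the chart [(x, mu_0, mu_j)] it follows the [n] base
    coordinates. *)
Definition flow_dir : 'rV[R]_(n + (1 + k)) := row_mx 0 (row_mx 1%:M 0).

Section Chart.
Variables (c : chart R n M) (t : triv R (1 + k) (vfib (dagger E))).
Hypotheses (Ac : matlas c) (At : vatlas t).
Let C := total_chart c t.

(** The constant function 1 has [mu_0 = 1] and [mu_j = 1 - 1 = 0], so the flow is a translation in
    the chart. *)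
Lemma cmap_flow s p : cdom C p ->
  cmap C (dagger_flow s p) = cmap C p + s *: flow_dir.
Proof.
case: p => m w [/= cm tm]; rewrite /flow_dir scale_row_mx add_row_mx.
rewrite scaler0 addr0 [in LHS]/= (addrC w) [tmap t _](v_linear At tm) addrC; congr (row_mx _ (_ + _ *: _)).
case: At tm => u Au <- um /=; rewrite /dagger_tmap /=; congr row_mx.
by apply/rowP => j; rewrite !mxE subrr.
Qed.

Lemma flow_cinv s z : (cmap C @` cdom C) z ->
  dagger_flow s (cinv C z) = cinv C (z + s *: flow_dir).
Proof.
move=> [p Cp <-]; rewrite total_cancel // -cmap_flow // total_cancel //.
Qed.

(** Coordinate derivatives commute with translations. *)
Lemma pderiv_flow i s (f : Defs.total (dagger E) -> R) p : cdom C p ->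
  pderiv C i (f \o dagger_flow s) p = pderiv C i f (dagger_flow s p).
Proof.
move=> Cp; rewrite /pderiv cmap_flow //.
transitivity ('D_(delta_mx 0 i) ((f \o cinv C) \o shift (s *: flow_dir)) (cmap C p)).
  apply: near_eq_derive.
  have : nbhs (cmap C p) (cmap C @` cdom C).
    by apply: open_nbhs_nbhs; split; [exact: total_im_open|exists p].
  by apply: filterS => z Dz; rewrite -[LHS]/(f (dagger_flow s (cinv C z))) flow_cinv.
by apply: eq_derive_line => r; rewrite /= addrA.
Qed.

End Chart.

Lemma csmooth_flow s f : csmooth (total_atlas (dagger E)) f ->
  csmooth (total_atlas (dagger E)) (f \o dagger_flow s).
Proof.
move=> sf _ [c [t [Ac At ->]]] l; rewrite setIT.
have oD := total_im_open Ac At.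
have := sf _ (ex_intro _ c (ex_intro _ t (And3 Ac At erefl))) l; rewrite setIT => cf.
set C := total_chart c t in oD cf *.
apply: (@Ck_ext _ _ _ _ ((f \o cinv C) \o shift (s *: flow_dir))) => //.
  by move=> z Dz; rewrite -[RHS]/(f (dagger_flow s (cinv C z))) flow_cinv.
apply: (Ck_comp (D' := cmap C @` cdom C)) => //.
  by move=> _ [p Cp <-]; exists (dagger_flow s p) => //; rewrite cmap_flow.
move=> i l'; apply: (@Ck_ext _ _ _ _ (fun z : 'rV[R]_(n + (1 + k)) => z 0 i + (s *: flow_dir) 0 i)) => //.
  by move=> z _; rewrite /= !mxE.
by apply: Ck_add => //; [exact: Ck_coord|exact: Ck_cst].
Qed.

End Flow.

(** * The bidual of an affine bundle *)

Section Bidual.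
Context {R : realType} {n : nat} {M : manifold R n} {k : nat} {V : vbundle M k}.
Variable E : affbundle V.

Definition unit_fun m : dagger E m := affine_one (act (m:=m) (a:=E)).

Definition coord_fun (t : triv R k (afib E)) m (j : 'I_k) : dagger E m :=
  dagger_tinv t m (delta_mx 0 (rshift 1 j)).

Lemma coord_funE (t : triv R k (afib E)) m j x : aatlas t -> tdom t m ->
  (coord_fun t m j : affine_fun _) x = tmap t x 0 j.
Proof.
move=> At tm; rewrite dagger_tinvE // !mxE eq_lrshift andbF add0r.
rewrite (bigD1 j) //= big1 ?addr0 => [|i ij]; rewrite !mxE /=.
  by rewrite eqxx mul1r.
by rewrite (inj_eq (@rshift_inj _ _)) (negbTE ij) mul0r.
Qed.

(** Expanding [f] as [mu_0 + \sum_j mu_j y^j] shows that [z] is determined by its values on 1 and on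
    the fibre coordinates [y^j]. *)
Lemma bidual_coord (t : triv R k (afib E)) m (z : bidual E m) (f : dagger E m) :
  aatlas t -> tdom t m ->
  (z : dual _) f = (f : affine_fun _) (tinv t m 0) * (z : dual _) (unit_fun m) +
    \sum_j ((f : affine_fun _) (tinv t m (delta_mx 0 j)) -
       (f : affine_fun _) (tinv t m 0)) * (z : dual _) (coord_fun t m j).
Proof.
move=> At tm; have Au : vatlas (dagger_triv t : triv R _ (vfib (dagger E))) by exists t.
rewrite -[in LHS](dagger_tmapK Au tm f).
rewrite (dual_form_tinv (W := dagger E) (t := dagger_triv t)) // big_split_ord /=.
rewrite big_ord1 row_mxEl mxE eqxx mulr1n; congr (_ * _ + _).
  congr (dual_fun z _); apply: affine_ext => x; rewrite dagger_tinvE // !mxE.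
  rewrite big1 ?addr0 ?eqxx // => i _.
  by rewrite !mxE eq_rlshift andbF mul0r.
by apply: eq_bigr => j _; rewrite row_mxEr mxE.
Qed.

Lemma bidual_can m (z : bidual E m) : (z : dual _) (unit_fun m) = 1 ->
  exists x, z = can x.
Proof.
have [t At tm] := a_cover E m => z1.
(* The point whose [j]-th coordinate is [z(y^j)]: evaluation there and [z] agree on 1 and on every
   [y^j]. *)
exists (tinv t m (\row_j (z : dual _) (coord_fun t m j))).
apply: dual_ext => f; rewrite (bidual_coord z f At tm) z1 mulr1.
rewrite [RHS](dagger_coord f _ At tm) a_tinvK //.
by congr (_ + _); apply: eq_bigr => j _; rewrite mxE.
Qed.

(** Adding [i(o)] moves [z] to the hyperplane of value 1, where it becomes some [i(x)]; then
    [v = x - o]. *)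
Lemma bidual_can_lin m (z : bidual E m) : (z : dual _) (unit_fun m) = 0 ->
  exists v, z = can_lin E v.
Proof.
have [t At tm] := a_cover E m => z0; pose o := tinv t m 0.
have [|x zx] := @bidual_can m (z + can o).
  by rewrite -[LHS]/((z : dual _) (unit_fun m) + 1) z0 add0r.
exists (adiff x o); apply: dual_ext => f.
have /(congr1 (fun y : bidual E m => (y : dual _) f)) := zx.
rewrite -[LHS]/((z : dual _) f + (f : affine_fun _) o) => zf.
apply: (addIr ((f : affine_fun _) o)); rewrite zf /=.
by rewrite -{1}(act_adiff x o) linear_partE addrC.
Qed.

Lemma can_lin_unit_fun m (v : V m) : (can_lin E v : dual _) (unit_fun m) = 0.
Proof.
have [t At tm] := a_cover E m.
have h : 1 = 1 + (can_lin E v : dual _) (unit_fun m) :> R.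
  exact: (linear_partE (affine_one (act (m:=m) (a:=E))) (tinv t m 0) v).
by apply: (addrI (1 : R)); rewrite addr0.
Qed.

Lemma vsmooth_can s : asmooth s -> vsmooth (fun m => can (s m) : bidual E m).
Proof.
move=> ss _ j [_ [t At <-] <-] /=.
apply: (@msmooth_on_affcomb _ _ _ _ k (lsubmx (delta_mx 0 j) 0 0)
  (fun i => rsubmx (delta_mx 0 j : 'rV[R]_(1 + k)) 0 i)
  (fun i m => tmap t (s m) 0 i)).
- exact: a_open.
- by move=> i; exact: ss.
- by move=> m tm; rewrite mxE /= dagger_tinvE.
Qed.

(** Over a trivialisation of E, [v] has the coefficients [z(y^i)] in the induced frame of V. These
    are fibre coordinates of [z], hence smooth, and the frame is smooth by [a_linear_inv_smooth]. *)
Lemma vsmooth_can_lin (z : forall m, bidual E m) : vsmooth z ->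
  (forall m, (z m : dual _) (unit_fun m) = 0) ->
  exists2 v, vsmooth v & forall m, z m = can_lin E (v m).
Proof.
move=> sz z0; pose v m : V m := sval (cid (bidual_can_lin (z0 m))).
have zv m : z m = can_lin E (v m) by rewrite /v; case: cid.
exists v => // t' j At'; apply: msmooth_on_local => p t'p.
have [t At tp] := a_cover E p; exists (tdom t `&` tdom t') => //.
have ott' : open (tdom t `&` tdom t') by apply: openI; [exact: a_open|exact: v_open].
(* The frame of V induced by [t]: the linear part of [t] sends [e i m] to [delta_mx 0 i]. *)
pose e i m : V m := adiff (tinv t m (delta_mx 0 i)) (tinv t m 0).
have vE m : tdom t m -> v m = \sum_i (z m : dual _) (coord_fun t m i) *: e i m.
  move=> tm; have [L tL] := a_affine At tm; set o := tinv t m 0.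
  have to : tmap t o = 0 by exact: a_tinvK.
  have [w [_ wu]] := act_torsor o (act o (v m)); rewrite -(wu (v m)) //; apply: wu.
  apply: (can_inj (a_tmapK At tm)).
  rewrite tL to add0r linear_sum [RHS]row_sum_delta; apply: eq_bigr => i _.
  rewrite linearZ /=; congr (_ *: _).
    rewrite zv /= -(coord_funE _ _ At tm) linear_partE coord_funE // -/o to mxE.
    by rewrite add0r.
  by rewrite -[L _]add0r -to -tL act_adiff a_tinvK.
apply: (@msmooth_on_ext _ _ _ _ (fun m =>
    \sum_i (z m : dual _) (coord_fun t m i) * tmap t' (e i m) 0 j)) => //.
  move=> m [tm t'm]; rewrite vE //.
  pose f : {linear V m -> 'rV[R]_k} := HB.pack_for {linear V m -> 'rV[R]_k}
    (tmap t' (m:=m)) (GRing.isLinear.Build R _ _ _ _ (v_linear At' t'm)).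
  rewrite -[tmap t' (m:=m)]/(f : _ -> _) linear_sum summxE.
  by apply: eq_bigr => i _; rewrite linearZ mxE.
apply: msmooth_on_sum => // i; apply: msmooth_on_mul => //.
  apply: (@msmooth_on_subset _ _ _ (tdom t)); first by move=> q [].
  have Au : vatlas (dual_triv (dagger_triv t : triv R _ (vfib (dagger E))) : triv R _ (vfib (bidual E))).
    by exists (dagger_triv t) => //; exists t.
  have := sz _ (rshift 1 i) Au; congr (msmooth_on _ _).
  by apply/funext => m; rewrite mxE.
by apply: a_linear_inv_smooth => // m tm; rewrite act_adiff.
Qed.

End Bidual.

(** * Poisson brackets as bilinear forms on covectors *)

Section Gradient.
Context {R : realType} {n : nat} {M : manifold R n}.

Definition grad N X (C : chart R N X) (f : X -> R) (p : X) : 'rV[R]_N :=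
  \row_i pderiv C i f p.

(** This reduces comparisons of brackets at points of one chart to matrix algebra on the
    gradients. *)
Lemma poisson_grad N X (A : set (chart R N X)) (L : poisson_tensor A) C : A C ->
  exists Lam : X -> 'M[R]_N, (forall p, cdom C p -> (Lam p)^T = - Lam p) /\
    forall f g p, csmooth A f -> csmooth A g -> cdom C p ->
      L f g p = (grad C f p *m Lam p *m (grad C g p)^T) 0 0.
Proof.
move=> AC; have [l [_ skew lE]] := pb_bivector L AC.
exists (fun p => \matrix_(i, j) l i j (cmap C p)); split.
  by move=> p Cp; apply/matrixP => i j; rewrite !mxE skew //; exists p.
move=> f g p sf sg Cp; rewrite lE // mxE exchange_big; apply: eq_bigr => j _ /=.
rewrite !mxE mulr_suml; apply: eq_bigr => i _; rewrite !mxE.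
by rewrite (mulrC (pderiv _ _ _ _)).
Qed.

Lemma poisson_antisym N X (A : set (chart R N X)) (L : poisson_tensor A) C f g p :
  A C -> cdom C p -> csmooth A f -> csmooth A g -> L f g p = - L g f p.
Proof.
move=> AC Cp sf sg; have [Lam [skew LE]] := poisson_grad L AC.
rewrite !LE // -[in RHS](trmxK (_ *m _ *m _)) [in RHS]mxE !trmx_mul trmxK.
by rewrite skew // mulNmx mulmxN [in RHS]mxE opprK mulmxA.
Qed.

(** The linear function with coefficients [b] in the chart, made global by a bump that leaves its
    germ at [m] unchanged. *)
Lemma exists_msmooth_pderiv (c : chart R n M) (m : M) (b : 'rV[R]_n) :
  matlas c -> cdom c m ->
  exists2 h, msmooth h & forall i, pderiv c i h m = b 0 i.
Proof.
move=> Ac cm; pose F (y : 'rV[R]_n) : R := \sum_i b 0 i * y 0 i.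
have sF : smooth_on setT F.
  move=> l; apply: Ck_sum => [|i]; first exact: openT.
  by apply: Ck_scale; [exact: openT|exact: Ck_coord].
have oc := m_dom_open Ac.
have [h sh hF] := msmooth_extend oc cm
  (msmooth_on_cmap (c := c) Ac oc (fun p cp => cp) (fun _ _ => I) sF).
exists h => // i; rewrite /pderiv.
have cx : (cmap c @` cdom c) (cmap c m) by exists m.
transitivity ('D_(delta_mx 0 i) F (cmap c m)).
  apply: near_eq_derive.
  have nh : \forall y \near cmap c m, h (cinv c y) = F (cmap c (cinv c y)).
    have cc := m_cinv_continuous Ac cx.
    by apply: (cc (fun q => h q = F (cmap c q))); rewrite /= m_cancel.
  have nc : nbhs (cmap c m) (cmap c @` cdom c).
    by apply: open_nbhs_nbhs; split => //; exact: m_im_open.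
  apply: filterS2 nh nc => y hy [p cp py]; rewrite /= hy.
  by rewrite -py m_cancel.
have -> : F = \sum_i b 0 i *: (fun y : 'rV[R]_n => y 0 i).
  by apply/funext => y; rewrite fct_sumE.
rewrite derive_sum => [|j]; last first.
  by apply: derivableZ; apply: diff_derivable; exact: differentiable_coord.
rewrite (bigD1 i) //= big1 ?addr0 => [|j ji].
  rewrite deriveZ; last by apply: diff_derivable; exact: differentiable_coord.
  by rewrite derive_coord mxE !eqxx /GRing.scale /= mulr1.
rewrite deriveZ; last by apply: diff_derivable; exact: differentiable_coord.
by rewrite derive_coord mxE (negbTE ji) andbF scaler0.
Qed.

End Gradient.

(** * Invariance of the Poisson tensor *)

Section Symmetry.
Context {R : realType} {n k : nat} {M : manifold R n} {V : vbundle M k}.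
Variable E : affbundle V.

Section Chart.
Variables (c : chart R n M) (t : triv R k (afib E)).
Hypotheses (Ac : matlas c) (At : aatlas t).
Let u : triv R (1 + k) (vfib (dagger E)) := dagger_triv t.
Let C := total_chart c u.

Let Au : vatlas u. Proof. by exists t. Qed.

Lemma grad_flow s (f : Defs.total (dagger E) -> R) p : cdom C p ->
  grad C (f \o dagger_flow s) p = grad C f (dagger_flow s p).
Proof. by move=> Cp; apply/rowP => i; rewrite !mxE pderiv_flow. Qed.

Lemma grad_pullback s (f : Defs.total (dagger E) -> R) p : cdom C p ->
  grad C (f \o dagger_flow (- s)) (dagger_flow s p) = grad C f p.
Proof.
move=> Cp; have Cs : cdom C (dagger_flow s p) by [].
by rewrite (grad_flow _ _ Cs) dagger_flowK.
Qed.

Lemma grad_flow_shift s a (f : Defs.total (dagger E) -> R) p : cdom C p ->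
  (forall q, f (dagger_flow s q) = f q + a) ->
  grad C f (dagger_flow s p) = grad C f p.
Proof.
move=> Cp fa; rewrite -grad_flow //; apply/rowP => i; rewrite !mxE.
rewrite (_ : f \o _ = fun q => f q + a); last by apply/funext.
rewrite /pderiv /derive; congr (lim _); rewrite (_ : (fun h => _) =
  (fun h => h^-1 *: (((f \o cinv C) \o shift (cmap C p)) (h *: 'e_i) -
     (f \o cinv C) (cmap C p)))) //.
by apply/funext => h /=; rewrite opprD addrACA subrr addr0.
Qed.

(* A covector with fibre part [z] in the bidual is [i(x) - a i(x0)] with
   [a = 1 - z(1)], because [z + a i(x0)] lies in the hyperplane of forms
   taking the value 1 at 1, which is the image of [i]. *)
Lemma covector_span p (al : 'rV[R]_(n + (1 + k))) : cdom C p ->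
  exists s s0 a h, [/\ asmooth s, asmooth s0, msmooth h &
    al = grad C (hat (fun m => can (s m) : bidual E m)) p
         - a *: grad C (hat (fun m => can (s0 m) : bidual E m)) p
         + grad C (basic h) p].
Proof.
case: p => m w Cp; have [/= cm tm] := Cp.
pose z : bidual E m := dual_tinv u m (\row_i al 0 (rshift n i)).
have zE i : (z : dual _) (tinv u m (delta_mx 0 i)) = al 0 (rshift n i).
  rewrite dual_tinvE // v_tinvK // (bigD1 i) //= big1 ?addr0 => [|j ji].
    by rewrite !mxE !eqxx mulr1.
  by rewrite !mxE (negbTE ji) andbF mulr0.
have [s0 [ss0 _]] := asmooth_through (tinv t m 0).
pose a := 1 - (z : dual _) (unit_fun E m).
have [|x zx] := @bidual_can _ _ _ _ _ E m (z + a *: can (s0 m)).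
  by rewrite -[LHS]/((z : dual _) (unit_fun E m) + a * 1) mulr1 addrC subrK.
have [s [ss sx]] := asmooth_through x.
(* What the two [hat] terms leave of [al]. Its base part is supplied by [basic h], which has no
   fibre derivative and so keeps the fibre part intact. *)
pose d i := al 0 i - (grad C (hat (fun m => can (s m) : bidual E m)) (existT _ m w)
  - a *: grad C (hat (fun m => can (s0 m) : bidual E m)) (existT _ m w)) 0 i.
have [h sh hE] := exists_msmooth_pderiv (\row_i d (lshift (1 + k) i)) Ac cm.
exists s, s0, a, h; split => //; apply/rowP => j; rewrite [RHS]mxE.
case: (split_ordP j) => i ->.
  rewrite [grad C (basic h) _ _ _]mxE pderiv_basic_base // hE [in RHS](mxE _ _ 0 i) /d.
  by rewrite [RHS]addrC subrK.
rewrite [grad C (basic h) _ _ _]mxE pderiv_basic_fibre // addr0.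
rewrite !mxE !pderiv_hat_fibre //= sx -zE -/u.
have zf : (z : dual _) (tinv u m (delta_mx 0 i)) +
    a * (can (s0 m) : dual _) (tinv u m (delta_mx 0 i)) =
    (can x : dual _) (tinv u m (delta_mx 0 i)).
  exact: (congr1 (fun y : bidual E m => (y : dual _) (tinv u m (delta_mx 0 i))) zx).
exact: (canRL (addrK _) zf).
Qed.

End Chart.

Variables (A : lie_algebroid (bidual E)) (L : poisson_tensor (total_atlas (dagger E))).
Hypothesis hL : associated_poisson A L.

Let can_sec (s : forall m, E m) : forall m, bidual E m := fun m => can (s m).

Lemma brk_can_vsmooth s1 s2 : asmooth s1 -> asmooth s2 ->
  vsmooth (brk A (can_sec s1) (can_sec s2)).
Proof. by move=> ss1 ss2; apply: brk_smooth; exact: vsmooth_can. Qed.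

Lemma hat_can_flow s m p : hat (can_sec s) (dagger_flow m p) = hat (can_sec s) p + m.
Proof. by rewrite hat_flow /= mulr1. Qed.

Lemma total_chart_at (p : Defs.total (dagger E)) :
  exists c t, [/\ matlas c, aatlas t &
    cdom (total_chart c (dagger_triv t : triv R (1 + k) (vfib (dagger E)))) p].
Proof.
have [c Ac cm] := m_cover (projT1 p); have [t At tm] := a_cover E (projT1 p).
by exists c, t.
Qed.

Lemma symmetry_brk_unit_fun s1 s2 m :
  is_lie_derivative (total_atlas (dagger E)) (dagger_flow (E := E)) L (fun _ _ _ => 0) ->
  asmooth s1 -> asmooth s2 ->
  (brk A (can_sec s1) (can_sec s2) m : dual _) (unit_fun E m) = 0.
Proof.
move=> sym ss1 ss2; have [hh _ _] := hL.
have v1 := vsmooth_can ss1; have v2 := vsmooth_can ss2.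
have c1 := csmooth_hat v1; have c2 := csmooth_hat v2.
(* At the zero covector [hat] of the bracket vanishes, so along the flow it is exactly [s * b]. *)
pose p : Defs.total (dagger E) := existT _ m (0 : dagger E m).
set b := (X in X = 0).
have [c [t [Ac At Cp]]] := total_chart_at p.
set C := total_chart _ _ in Cp.
have AC : total_atlas (dagger E) C by exists c, (dagger_triv t); split => //; exists t.
have [Lam [_ LE]] := poisson_grad L AC.
(* The pulled-back functions have at [dagger_flow s p] the gradients of the originals at [p]. These
   equal the gradients of the originals at [dagger_flow s p], so the bracket relation applies
   there. *)
have LsE s : L (hat (can_sec s1) \o dagger_flow (- s)) (hat (can_sec s2) \o dagger_flow (- s))
    (dagger_flow s p) = s * b.
  have Cs : cdom C (dagger_flow s p) by [].
  rewrite LE //; try exact: csmooth_flow.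
  rewrite !grad_pullback //.
  rewrite -(grad_flow_shift Ac At Cp (hat_can_flow s1 s)).
  rewrite -(grad_flow_shift Ac At Cp (hat_can_flow s2 s)) -LE //.
  rewrite hh // hat_flow /= -[RHS]add0r; congr (_ + _).
  by rewrite /hat /= linear0.
have := sym _ _ p c1 c2; rewrite (_ : (fun s => _) = (fun s => s * b)); last first.
  by apply/funext => s; exact: LsE.
(* The derivative of [s * b] at 0 is both 0, by the symmetry, and [b]. *)
move=> [_ d0]; suff [_ d1] : is_derive (0 : R) (1 : R) (fun s : R => s * b) b.
  by rewrite -d1.
by apply: is_derive_eq; rewrite /GRing.scale /= mul0r mulr1 add0r.
Qed.

(** By [covector_span] the differentials of these functions span every cotangent space. *)
Definition frame_fun (f : Defs.total (dagger E) -> R) : Prop :=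
  (exists2 s, asmooth s & f = hat (can_sec s)) \/ (exists2 h, msmooth h & f = basic h).

Lemma frame_fun_csmooth f : frame_fun f -> csmooth (total_atlas (dagger E)) f.
Proof.
by move=> [[s ss ->]|[h sh ->]]; [apply: csmooth_hat; exact: vsmooth_can|exact: csmooth_basic].
Qed.

Lemma frame_fun_flow f s : frame_fun f -> exists a, forall q, f (dagger_flow s q) = f q + a.
Proof.
move=> [[z _ ->]|[h _ ->]]; first by exists s => q; exact: hat_can_flow.
by exists 0 => q; rewrite addr0.
Qed.

(** Two [hat] functions bracket to a [hat] function of slope 0 along the flow; a [hat] and a [basic]
    one give an anchor term depending only on the base point; two [basic] ones give 0. *)
Lemma frame_fun_bracket f g s p :
  (forall s1 s2 m, asmooth s1 -> asmooth s2 ->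
     (brk A (can_sec s1) (can_sec s2) m : dual _) (unit_fun E m) = 0) ->
  frame_fun f -> frame_fun g -> L f g (dagger_flow s p) = L f g p.
Proof.
move=> b0; have [hh hb bb] := hL.
have hbE z h : asmooth z -> msmooth h ->
    L (hat (can_sec z)) (basic h) (dagger_flow s p) = L (hat (can_sec z)) (basic h) p.
  by move=> sz sh; rewrite !hb //; exact: vsmooth_can.
move=> ff fg; have cf := frame_fun_csmooth ff; have cg := frame_fun_csmooth fg.
case: ff fg cf cg => [[z sz ->]|[h sh ->]] [[z' sz' ->]|[h' sh' ->]] cf cg.
- rewrite !hh; try exact: vsmooth_can.
  by rewrite hat_flow b0 // mulr0 addr0.
- exact: hbE.
(* [associated_poisson] prescribes the mixed bracket with [hat] first; antisymmetry gives the other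
   order. *)
- have [c [t [Ac At Cp]]] := total_chart_at p.
  set C := total_chart _ _ in Cp.
  have AC : total_atlas (dagger E) C by exists c, (dagger_triv t); split => //; exists t.
  have Cs : cdom C (dagger_flow s p) by [].
  rewrite (poisson_antisym L AC Cs cf cg) (poisson_antisym L AC Cp cf cg).
  by rewrite hbE.
- by rewrite !bb.
Qed.

Lemma brk_unit_fun_symmetry :
  (forall s1 s2 m, asmooth s1 -> asmooth s2 ->
     (brk A (can_sec s1) (can_sec s2) m : dual _) (unit_fun E m) = 0) ->
  is_lie_derivative (total_atlas (dagger E)) (dagger_flow (E := E)) L (fun _ _ _ => 0).
Proof.
move=> b0 f g p sf sg; have [c [t [Ac At Cp]]] := total_chart_at p.
set C := total_chart _ _ in Cp.
have AC : total_atlas (dagger E) C by exists c, (dagger_triv t); split => //; exists t.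
have [Lam [_ LE]] := poisson_grad L AC.
(* The function of [s] is in fact constant, so its derivative is 0. *)
suff E0 s : L (f \o dagger_flow (- s)) (g \o dagger_flow (- s)) (dagger_flow s p) = L f g p.
  rewrite (_ : (fun s => _) = cst (L f g p)); first exact: is_derive_cst.
  by apply/funext => s; exact: E0.
have Cs : cdom C (dagger_flow s p) by [].
rewrite LE //; try exact: csmooth_flow.
rewrite !grad_pullback // LE //; apply/eqP; rewrite -subr_eq0.
(* The change of the Poisson matrix along the flow, kept opaque. Frame functions have equal
   gradients and equal brackets at both points, so [D] vanishes on their gradients. *)
have [D DE] : exists D, D = Lam (dagger_flow s p) - Lam p by eexists.
have frame0 f1 g1 : frame_fun f1 -> frame_fun g1 ->
    (grad C f1 p *m D *m (grad C g1 p)^T) 0 0 = 0.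
  move=> ff fg; have cf := frame_fun_csmooth ff; have cg := frame_fun_csmooth fg.
  have [a fa] := frame_fun_flow s ff; have [b gb] := frame_fun_flow s fg.
  have := frame_fun_bracket s p b0 ff fg; rewrite !LE //.
  rewrite (grad_flow_shift Ac At Cp fa) (grad_flow_shift Ac At Cp gb) => e.
  by rewrite DE mulmxBr mulmxBl mxE [X in _ + X]mxE e subrr.
pose Q (v w : 'rV[R]_(n + (1 + k))) := (v *m D *m w^T) 0 0.
have QDl v1 v2 v3 w a : Q (v1 - a *: v2 + v3) w = Q v1 w - a * Q v2 w + Q v3 w.
  rewrite /Q !mulmxDl !mulNmx -!scalemxAl.
  by rewrite mxE [X in X + _]mxE [X in _ + X + _]mxE [X in _ - X + _]mxE.
have QDr v1 v2 v3 w a : Q w (v1 - a *: v2 + v3) = Q w v1 - a * Q w v2 + Q w v3.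
  have -> : Q w (v1 - a *: v2 + v3) = (w *m D *m (v1^T - a *: v2^T + v3^T)) 0 0.
    by congr ((_ *m _) 0 0); apply/matrixP => i j; rewrite !mxE.
  by rewrite /Q !mulmxDr mulmxN -scalemxAr mxE [X in X + _]mxE [X in _ + X + _]mxE [X in _ - X + _]mxE.
(* Bilinearity extends the vanishing to all covectors, first in the second slot and then in the
   first. *)
have spanr f1 al : frame_fun f1 -> Q (grad C f1 p) al = 0.
  move=> ff; have [z [z0 [a [h [sz sz0 sh ->]]]]] := covector_span Ac At al Cp.
  rewrite QDr /Q !frame0 ?mulr0 ?subr0 ?addr0 //; [right|left|left]; first by exists h.
    by exists z0.
  by exists z.
have spanl al be : Q al be = 0.
  have [z [z0 [a [h [sz sz0 sh ->]]]]] := covector_span Ac At al Cp.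
  rewrite QDl !spanr ?mulr0 ?subr0 ?addr0 //; [right|left|left]; first by exists h.
    by exists z0.
  by exists z.
have := spanl (grad C f p) (grad C g p).
by rewrite /Q DE mulmxBr mulmxBl mxE [X in _ + X]mxE => ->.
Qed.

End Symmetry.

Theorem mainTheorem3 (R : realType) (n k : nat) (M : manifold R n)
    (V : vbundle M k) (E : affbundle V)
    (A : lie_algebroid (bidual E))
    (L : poisson_tensor (total_atlas (dagger E)))
    (hL : associated_poisson A L) :
  (forall s1 s2 : forall m : M, E m, asmooth s1 -> asmooth s2 ->
     exists2 v : forall m : M, V m, vsmooth v &
       forall m : M,
         brk A (fun m => can (s1 m)) (fun m => can (s2 m)) m = can_lin E (v m))
  <-> is_lie_derivative (total_atlas (dagger E)) (dagger_flow (E := E)) L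
        (fun _ _ _ => 0).
Proof.
split=> [sec|sym s1 s2 ss1 ss2].
  apply: (brk_unit_fun_symmetry hL) => s1 s2 m ss1 ss2.
  by have [v _ ->] := sec _ _ ss1 ss2; exact: can_lin_unit_fun.
apply: vsmooth_can_lin; first exact: brk_can_vsmooth.
by move=> m; exact: (symmetry_brk_unit_fun hL m sym ss1 ss2).
Qed.
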